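(* Let $\{\varphi_j:1\le j\le N\}\subset L^2(K)$ be such that $\{\varphi_j(\cdot-u(k)):1\le j\le N,\ k\in\mathbb{N}_0\}$ is a frame for its closed linear span. For $0\le r\le q-1$ and $1\le l,j\le N$ let $\{h^r_{ljk}:k\in\mathbb{N}_0\}\in\ell^2(\mathbb{N}_0)$, and define $\psi^r_l(x)=q^{1/2}\sum_{j=1}^N\sum_{k\in\mathbb{N}_0}h^r_{ljk}\varphi_j(\mathfrak{p}^{-1}x-u(k))$. Let $H(\xi)$ be the $qN\times qN$ matrix associated with the $h^r_{ljk}$, let $\lambda(\xi)$ and $\Lambda(\xi)$ be the minimal and maximal eigenvalues of $H^*(\xi)H(\xi)$, and put $\lambda=\inf_\xi\lambda(\xi)$, $\Lambda=\sup_\xi\Lambda(\xi)$. Suppose $0<\lambda\le\Lambda<\infty$. Then for all $g\in L^2(K)$, $$\lambda\sum_{l=1}^N\sum_{k\in\mathbb{N}_0}\bigl|\langle g,q^{1/2}\varphi_l(\mathfrak{p}^{-1}\cdot-u(k))\rangle\bigr|^2\le\sum_{s=0}^{q-1}\sum_{l=1}^N\sum_{k\in\mathbb{N}_0}\bigl|\langle g,\psi^s_l(\cdot-u(k))\rangle\bigr|^2\le\Lambda\sum_{l=1}^N\sum_{k\in\mathbb{N}_0}\bigl|\langle g,q^{1/2}\varphi_l(\mathfrak{p}^{-1}\cdot-u(k))\rangle\bigr|^2.$$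
   Context: $K$ is a local field (a nondiscrete, totally disconnected, locally compact topological field) of characteristic $p>0$. Let $dx$ be Haar measure on the additive group $K^+$ and $|\cdot|$ the absolute value given by $d(\alpha x)=|\alpha|\,dx$, $|0|=0$. Put $\mathfrak{D}=\{x:|x|\le1\}$, $\mathfrak{P}=\{x:|x|<1\}$, $\mathfrak{D}^*=\mathfrak{D}\setminus\mathfrak{P}$; $dx$ is normalized so that $\mathfrak{D}$ has measure $1$. $\mathfrak{p}$ is a fixed element of $\mathfrak{P}$ of maximal absolute value (a prime element), $\mathfrak{D}/\mathfrak{P}\cong GF(q)$ with $q=p^c$, and $|\mathfrak{p}|=q^{-1}$. $\mathbb{N}_0=\{0,1,2,\dots\}$. Fix $\{1=\epsilon_0,\epsilon_1,\dots,\epsilon_{c-1}\}\subset\mathfrak{D}^*$ whose $GF(p)$-linear span is isomorphic to $GF(q)$ (as a field). For $0\le n<q$ with $n=a_0+a_1p+\cdots+a_{c-1}p^{c-1}$, $0\le a_k<p$, put $u(n)=(a_0+a_1\epsilon_1+\cdots+a_{c-1}\epsilon_{c-1})\mathfrak{p}^{-1}$; for general $n\in\mathbb{N}_0$ with $n=b_0+b_1q+\cdots+b_sq^s$, $0\le b_k<q$, put $u(n)=u(b_0)+u(b_1)\mathfrak{p}^{-1}+\cdots+u(b_s)\mathfrak{p}^{-s}$. Then $\{u(n)\}_{n\ge0}$ is a complete list of distinct coset representatives of $\mathfrak{D}$ in $K^+$. $\chi$ is the continuous unitary character of $K^+$ determined by $\chi(\epsilon_\mu\mathfrak{p}^{-j})=\exp(2\pi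 i/p)$ if $\mu=0$ and $j=1$, and $\chi(\epsilon_\mu\mathfrak{p}^{-j})=1$ if $\mu\in\{1,\dots,c-1\}$ or $j\ne1$; it is trivial on $\mathfrak{D}$ and nontrivial on $\mathfrak{p}^{-1}\mathfrak{D}$. Put $\chi_k(\xi)=\chi(u(k)\xi)$ for $k\in\mathbb{N}_0$; $\chi_k(u(l))=1$ for all $k,l\in\mathbb{N}_0$, so a series $\sum_kc_k\overline{\chi_k}$ with $(c_k)\in\ell^2(\mathbb{N}_0)$ (convergent in $L^2(\mathfrak{D})$) defines a.e. on $K$ a function invariant under all translations by $u(l)$. A countable family $\{x_k\}$ in a Hilbert space $\mathcal{H}$ is a frame for $\mathcal{H}$ if there are constants $0<C_1\le C_2<\infty$ with $C_1\|x\|^2\le\sum_k|\langle x,x_k\rangle|^2\le C_2\|x\|^2$ for all $x\in\mathcal{H}$. Matrices: $h^r_{lj}(\xi)=q^{-1/2}\sum_{k\in\mathbb{N}_0}h^r_{ljk}\overline{\chi_k(\xi)}$, $H_r(\xi)=\bigl(h^r_{lj}(\xi)\bigr)_{1\le l,j\le N}$, and $H(\xi)=\bigl(H_r(\xi+\mathfrak{p}u(s))\bigr)_{0\le r,s\le q-1}$ is the block matrix with $(r,s)$ block $H_r(\xi+\mathfrak{p}u(s))$. Infima and suprema over $\xi$ are understood up to null sets. *)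

(* Defs.v *)
From HB Require Import structures.
From mathcomp Require Import all_boot all_order all_algebra.
From mathcomp Require Import all_classical all_reals all_analysis.
From mathcomp Require Import ess_sup_inf complex.

Set Implicit Arguments.
Unset Strict Implicit.
Unset Printing Implicit Defensive.
Import Order.TTheory GRing.Theory Num.Theory.
Import numFieldNormedType.Exports.

Local Open Scope classical_set_scope.
Local Open Scope ring_scope.

HB.mixin Record TopologicalZmodule_isTopologicalField K
    & GRing.Field K & TopologicalZmodule K := {
  topfield_mul_continuous : continuous (fun x : K * K => x.1 * x.2) ;
  topfield_inv_continuous :
    forall x : K, x != 0 -> {for x, continuous (fun y : K => y^-1)}
}.

#[short(type="topologicalFieldType")]
HB.structure Definition TopologicalField :=
  {K of GRing.Field K & TopologicalZmodule K
      & TopologicalZmodule_isTopologicalField K}.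

(* Needed only because measurable types must be pointed. *)
#[non_forgetful_inheritance]
HB.instance Definition _ (K : topologicalFieldType) := isPointed.Build K 0.

(* Locally compact spaces are Hausdorff by convention; [totally_disconnected]
   already forces it for a topological group. *)
Record local_field (K : topologicalFieldType) : Prop := {
  local_field_hausdorff : hausdorff_space K ;
  local_field_nondiscrete : ~ open [set (0 : K)] ;
  local_field_totally_disconnected : totally_disconnected [set: K] ;
  local_field_locally_compact : locally_compact [set: K]
}.

Notation borel K := (g_sigma_algebraType (@open K)).

Section Haar.
Context {R : realType} {K : topologicalFieldType}.
Variable mu : {measure set (borel K) -> \bar R}.
Local Open Scope ereal_scope.

(* A nonzero translation-invariant Radon measure on the additive group. *)
Record haar_measure : Prop := {
  haar_neq0 : 0 < mu [set: K] ;
  haar_translation : forall (a : K) (E : set K),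
    measurable (E : set (borel K)) -> mu [set (a + x)%R | x in E] = mu E ;
  haar_compact : forall E : set K, compact E -> mu E < +oo ;
  haar_outer_regular : forall E : set K, measurable (E : set (borel K)) ->
    mu E = ereal_inf [set mu U | U in [set U : set K | open U /\ E `<=` U]] ;
  haar_inner_regular : forall U : set K, open U ->
    mu U = ereal_sup [set mu E | E in [set E : set K | compact E /\ E `<=` U]]
}.

(* d(a x) = |a| dx, and |0| = 0. *)
Definition haar_modulus (abs : K -> R) : Prop :=
  abs 0%R = 0%R /\
  forall (a : K) (E : set K), a != 0%R -> measurable (E : set (borel K)) ->
    mu [set (a * x)%R | x in E] = (abs a)%:E * mu E.

End Haar.

Section LocalFieldData.
Context {R : realType} {K : fieldType}.
Variable abs : K -> R.

Definition int_ring : set K := [set x | abs x <= 1].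
Definition max_ideal : set K := [set x | abs x < 1].

Definition prime_element (varpi : K) : Prop :=
  max_ideal varpi /\ forall x, max_ideal x -> abs x <= abs varpi.

(* int_ring / max_ideal is a field with q elements: there is a surjective ring
   morphism from int_ring onto such a field, with kernel max_ideal.  The values
   of f outside int_ring are irrelevant. *)
Definition residue_field_card (q : nat) : Prop :=
  exists (F : finFieldType) (f : K -> F),
    #|F| = q /\
    [/\ f 1 = 1,
        forall x y, int_ring x -> int_ring y -> f (x + y) = f x + f y,
        forall x y, int_ring x -> int_ring y -> f (x * y) = f x * f y,
        forall z, exists2 x, int_ring x & f x = z
      & forall x, int_ring x -> (f x = 0 <-> max_ideal x)].

Variables p c : nat.

Definition prime_span (eps : 'I_c -> K) : set K :=
  [set \sum_(i < c) (a i)%:R * eps i | a in [set: 'I_c -> nat]].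

(* The span is the image of GF(p ^ c) under a field embedding into K. *)
Definition residue_basis (eps : 'I_c -> K) : Prop :=
  [/\ forall i : 'I_c, i = 0%N :> nat -> eps i = 1,
      forall i, (int_ring `\` max_ideal) (eps i)
    & exists (F : finFieldType) (f : {rmorphism F -> K}),
        #|F| = (p ^ c)%N /\ range f = prime_span eps].

Variables (eps : 'I_c -> K) (varpi : K).

Definition u_digit (n : nat) : K :=
  (\sum_(k < c) ((n %/ p ^ k) %% p)%:R * eps k) * varpi^-1.

(* The base-q digits of n of index > n vanish. *)
Definition u (n : nat) : K :=
  let q := (p ^ c)%N in
  \sum_(k < n.+1) u_digit ((n %/ q ^ k) %% q) * varpi ^- k.

End LocalFieldData.

Definition basic_character {R : realType} {K : topologicalFieldType}
    (p c : nat) (eps : 'I_c -> K) (varpi : K) (chi : K -> R[i]) : Prop :=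
  [/\ continuous (fun x => complex.Re (chi x)) /\
      continuous (fun x => complex.Im (chi x)),
      forall x y, chi (x + y) = chi x * chi y,
      forall x, `|chi x| = 1
    & forall (i : 'I_c) (j : int),
        chi (eps i * varpi ^ (- j)) =
          if (i == 0%N :> nat) && (j == 1) then
            (cos (2 * pi / p%:R) +i* sin (2 * pi / p%:R))%C
          else 1].

(* |z|^2 as an extended real. *)
Definition sqmod {R : realType} (z : R[i]) : \bar R :=
  (complex.Re z ^+ 2 + complex.Im z ^+ 2)%:E.

Section L2.
Context {R : realType} {K : topologicalFieldType}.
Variable mu : {measure set (borel K) -> \bar R}.
Local Notation C := R[i].

Definition sqnorm_on (A : set K) (f : K -> C) : \bar R :=
  (\int[mu]_(x in (A : set (borel K))) sqmod (f x))%E.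

(* Elements of L^2(A) are represented by functions, not by classes. *)
Definition L2_on (A : set K) (f : K -> C) : Prop :=
  [/\ measurable_fun (A : set (borel K)) (fun x : borel K => complex.Re (f x)),
      measurable_fun (A : set (borel K)) (fun x : borel K => complex.Im (f x))
    & (sqnorm_on A f < +oo)%E].

Definition L2 : set (K -> C) := [set f | L2_on [set: K] f].

Definition inner (f g : K -> C) : C :=
  ((\int[mu]_x complex.Re (f x * (g x)^*)) +i*
   (\int[mu]_x complex.Im (f x * (g x)^*)))%C.

(* f is the sum in L^2(A) of the series with terms t 0, t 1, t 2, etc. *)
Definition L2_series_on (A : set K) (t : nat -> K -> C) (f : K -> C) : Prop :=
  L2_on A f /\
  (fun n => sqnorm_on A (fun x => f x - \sum_(k < n) t k x)) @ \oo --> 0%E.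

Definition lin_span (I : Type) (x : I -> K -> C) : set (K -> C) :=
  [set f | exists (s : seq I) (a : I -> C),
     f = fun t => \sum_(i <- s) a i * x i t].

Definition closed_lin_span (I : Type) (x : I -> K -> C) : set (K -> C) :=
  [set f | L2 f /\ forall e : R, 0 < e ->
     exists2 g, lin_span x g & (sqnorm_on [set: K] (fun t => (f t - g t)%R) < e%:E)%E].

(* H is meant to be a closed subspace of L^2(K). *)
Definition frame_for (I : countType) (H : set (K -> C)) (x : I -> K -> C) :
    Prop :=
  (forall i, H (x i)) /\
  exists C1 C2 : R, [/\ 0 < C1, C1 <= C2 & forall f, H f ->
    (C1%:E * sqnorm_on [set: K] f <=
       \esum_(i in [set: I]) sqmod (inner f (x i)))%E /\
    (\esum_(i in [set: I]) sqmod (inner f (x i)) <=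
       C2%:E * sqnorm_on [set: K] f)%E].

End L2.

Definition l2_seq {R : realType} (a : nat -> R[i]) : Prop :=
  (\sum_(0 <= k <oo) sqmod (a k) < +oo)%E.

(* The extremal real eigenvalues; used for Hermitian matrices, all of whose
   eigenvalues are real, so that inf and sup are attained. *)
Definition min_eigenvalue {R : realType} n (A : 'M[R[i]]_n) : R :=
  inf [set a : R | eigenvalue A a%:C%C].
Definition max_eigenvalue {R : realType} n (A : 'M[R[i]]_n) : R :=
  sup [set a : R | eigenvalue A a%:C%C].

(* The block matrix with (r, s) block (h^r_{lj}(xi + varpi u(s)))_{l,j}. *)
Definition H_matrix {R : realType} {K : fieldType} (q N : nat) (varpi : K)
    (un : nat -> K) (h : 'I_q -> 'I_N -> 'I_N -> K -> R[i]) (xi : K) :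
    'M[R[i]]_(\sum_(i < q) N) :=
  \mxblock_(r < q, s < q) \matrix_(l < N, j < N) h r l j (xi + varpi * un s).

Definition gram {R : realType} n (A : 'M[R[i]]_n) : 'M[R[i]]_n :=
  (map_mx (@Num.conj R[i]) A)^T *m A.

(* Main.v *)
Require Import Defs.
From HB Require Import structures.
From mathcomp Require Import all_boot all_order all_algebra.
From mathcomp Require Import all_classical all_reals all_analysis.
From mathcomp Require Import measurable_realfun ess_sup_inf complex.
From mathcomp Require Import spectral sesquilinear.
From mathcomp Require Import ring lra zify.
Set Implicit Arguments.
Unset Strict Implicit.
Unset Printing Implicit Defensive.
Import Order.TTheory GRing.Theory Num.Theory.
Import numFieldNormedType.Exports.
Local Open Scope classical_set_scope.
Local Open Scope ring_scope.

(** Put c_j(k) = <g, q^(1/2) phi_j(varpi^-1 x - u(k))> and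
    d^r_l(k) = <g, psi^r_l(x - u(k))>: the theorem compares the sums of the
    |c_j(k)|^2 and of the |d^r_l(k)|^2.

    GF(q) embeds in K, and n |-> u(n) enumerates the elements
    varpi^-1 P(varpi^-1) for P a polynomial over GF(q).  So the u(n) form a group,
    and varpi^-1 u(k) = u(qk).  Expanding psi^r_l therefore gives
    d^r_l(k) = sum over j and m of conj(h^r_ljm) c_j(m'), where
    u(m') = u(qk) + u(m): the sequences c_j are correlated with the filters and
    the result is kept at the multiples of q only.

    Suppose that c is finitely supported, and let C_j be the trigonometric
    polynomial with coefficients c_j(i) on the characters conj(chi_i).
    Correlation becomes multiplication by conj(h), and keeping the multiples of q
    becomes summation over the translates by varpi u(s), s < q.  By Parseval
    ([parseval], [decimated_parseval]) the sum of the |d^r_l(k)|^2 is q^-1 times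
    the integral over the ring of integers of |H(xi) w(xi)|^2, where w(xi) has
    entries conj(C_j(xi + varpi u(s))).  The eigenvalues of the Gram matrix of
    H(xi) bound the integrand pointwise ([H_matrix_bounds]), and the integral of
    |w|^2 is q times the sum of the |c_j(i)|^2; whence [decimated_lower] and
    [decimated_upper].

    In general c is square-summable, by the Bessel inequality that the upper frame
    bound implies ([synthesis_bound], [bessel_of_synthesis]).  The u(m) with
    m < q^t form a subgroup, so for qk < q^t the output at k of c truncated to
    indices below q^t is exactly the partial sum over m < q^t of the series for
    d^r_l(k) ([decimated_correlation]).  The truncated outputs thus converge to d,
    and both inequalities pass to the limit ([limit_upper], [limit_lower]).

    Orthogonality of the characters needs the ring of integers to be closed under
    addition, although |.| is only known as a Haar modulus.  Local compactness
    bounds |x + y| for integers x and y; in characteristic p this applies to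
    x^(p^n) + y^(p^n) = (x + y)^(p^n), and forces |x + y| <= 1 ([int_ringD]). *)

(** * Squared moduli of complex numbers *)

Section ComplexParts.
Context {R : realType}.
Local Notation C := R[i].
Implicit Types z w : C.

Lemma ReD z w : complex.Re (z + w) = complex.Re z + complex.Re w.
Proof. by case: z w => [? ?] [? ?]. Qed.

Lemma ImD z w : complex.Im (z + w) = complex.Im z + complex.Im w.
Proof. by case: z w => [? ?] [? ?]. Qed.

Lemma ReM z w :
  complex.Re (z * w) = complex.Re z * complex.Re w - complex.Im z * complex.Im w.
Proof. by case: z w => [? ?] [? ?]. Qed.

Lemma ImM z w :
  complex.Im (z * w) = complex.Re z * complex.Im w + complex.Im z * complex.Re w.
Proof. by case: z w => [? ?] [? ?]. Qed.

Lemma ReJ z : complex.Re z^* = complex.Re z. Proof. by case: z. Qed.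
Lemma ImJ z : complex.Im z^* = - complex.Im z. Proof. by case: z. Qed.
Lemma ReN z : complex.Re (- z) = - complex.Re z. Proof. by case: z. Qed.
Lemma ImN z : complex.Im (- z) = - complex.Im z. Proof. by case: z. Qed.

Lemma complexP z w :
  complex.Re z = complex.Re w -> complex.Im z = complex.Im w -> z = w.
Proof. by case: z w => [? ?] [? ?] /= -> ->. Qed.

(** The square modulus as an element of R: [sqmod z] is [(sqn z)%:E] by
    definition. *)
Definition sqn (z : C) : R := complex.Re z ^+ 2 + complex.Im z ^+ 2.

Lemma sqnC z : (sqn z)%:C%C = z * z^*.
Proof. by rewrite -sqr_normc -add_Re2_Im2. Qed.

Lemma sum_sqnC (I : finType) (F : I -> C) :
  (\sum_i sqn (F i))%:C%C = \sum_i F i * (F i)^*.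
Proof. by rewrite rmorph_sum /=; apply: eq_bigr => i _; rewrite sqnC. Qed.

Lemma conj_realC (x : R) : (x%:C%C : C)^* = x%:C%C.
Proof. exact: conjc_real. Qed.

Lemma sqn_ge0 z : 0 <= sqn z.
Proof. by rewrite addr_ge0 // sqr_ge0. Qed.

Lemma sqnM z w : sqn (z * w) = sqn z * sqn w.
Proof. by rewrite /sqn ReM ImM; ring. Qed.

Lemma sqnJ z : sqn z^* = sqn z.
Proof. by rewrite /sqn ReJ ImJ sqrrN. Qed.

Lemma sqnN z : sqn (- z) = sqn z.
Proof. by rewrite /sqn ReN ImN !sqrrN. Qed.

Lemma sqn0 : sqn (0 : C) = 0.
Proof. by rewrite /sqn /= expr0n addr0. Qed.

Lemma sqn_eq0 z : sqn z = 0 -> z = 0.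
Proof.
move=> /eqP; rewrite paddr_eq0 ?sqr_ge0 // !sqrf_eq0 => /andP[/eqP zr /eqP zi].
exact: complexP.
Qed.

Lemma sqn_real (x : R) : sqn x%:C%C = x ^+ 2.
Proof. by rewrite /sqn /= [0 ^+ 2]expr0n addr0. Qed.

Lemma sqn_norm1 z : `|z| = 1 -> sqn z = 1.
Proof.
move=> z1; apply: complexI; rewrite sqnC.
by have := sqr_normc z; rewrite z1 expr1n => <-.
Qed.

(** The difference of the two sides is t |z - w/t|^2. *)
Lemma sqnD_le z w (t : R) : 0 < t ->
  sqn (z + w) <= (1 + t) * sqn z + (1 + t^-1) * sqn w.
Proof.
move=> t0; rewrite -subr_ge0 /sqn ReD ImD.
set a := complex.Re z; set b := complex.Im z.
set c := complex.Re w; set d := complex.Im w.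
have -> : (1 + t) * (a ^+ 2 + b ^+ 2) + (1 + t^-1) * (c ^+ 2 + d ^+ 2) -
    ((a + c) ^+ 2 + (b + d) ^+ 2) =
    t * ((a - t^-1 * c) ^+ 2 + (b - t^-1 * d) ^+ 2).
  by field; exact: lt0r_neq0.
by apply: mulr_ge0; [exact: ltW|apply: addr_ge0; exact: sqr_ge0].
Qed.

Lemma sqnD_le2 z w : sqn (z + w) <= 2 * sqn z + 2 * sqn w.
Proof. by have := sqnD_le z w ltr01; rewrite invr1. Qed.

Lemma sqrtC_nat_real (n : nat) : exists2 s : R, sqrtC (n%:R : C) = s%:C%C & s ^+ 2 = n%:R.
Proof.
have s0 : 0 <= sqrtC (n%:R : C) by rewrite sqrtC_ge0 ler0n.
have sE : sqrtC (n%:R : C) = (complex.Re (sqrtC (n%:R : C)))%:C%C.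
  by rewrite RRe_real // ger0_real.
exists (complex.Re (sqrtC (n%:R : C))) => //.
by apply: complexI; rewrite rmorphXn /= -sE sqrtCK rmorph_nat.
Qed.

Lemma sqn_sqrtC (n : nat) : sqn (sqrtC (n%:R : C)) = n%:R.
Proof. by have [s -> <-] := sqrtC_nat_real n; rewrite sqn_real. Qed.

Lemma conj_sqrtC (n : nat) : (sqrtC (n%:R : C))^* = sqrtC (n%:R : C).
Proof. by have [s -> _] := sqrtC_nat_real n; exact: conjc_real. Qed.

End ComplexParts.

(** * Rayleigh quotients of Gram matrices *)

Section Spectral.
Context {R : realType}.
Local Notation C := R[i].

Lemma colnormE n (w : 'cV[C]_n) :
  ((map_mx (@Num.conj C) w)^T *m w) 0 0 = (\sum_i sqn (w i 0))%:C%C.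
Proof. by rewrite sum_sqnC mxE; apply: eq_bigr => i _; rewrite !mxE mulrC. Qed.

Lemma gram_hermsym n (A : 'M[C]_n) : gram A \is hermsymmx.
Proof.
apply/is_hermitianmxP; rewrite expr0 scale1r /gram trmx_mul trmxK map_mxM /=.
rewrite map_trmx -map_mx_comp; congr (_ *m _); apply/esym/map_mx_id => x.
by rewrite /= conjCK.
Qed.

Section Rayleigh.
Variables (n : nat) (A : 'M[C]_n).
Hypothesis Ah : A \is hermsymmx.

Let P := spectralmx A.
Let D := spectral_diag A.

Let AE : A = invmx P *m diag_mx D *m P.
Proof. exact/orthomx_spectralP/hermitian_normalmx. Qed.

Let DE i : D 0 i = (complex.Re (D 0 i))%:C%C.
Proof.
by rewrite RRe_real //; apply: (mxOverP (hermitian_spectral_diag_real Ah)).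
Qed.

Let eigenD i : eigenvalue A (D 0 i).
Proof.
apply/eigenvalueP; exists (delta_mx 0 i *m P).
  rewrite {1}AE !mulmxA mulmxK ?spectral_unit // scalemxAl; congr (_ *m _).
  apply/rowP => j; rewrite mul_mx_diag !mxE eqxx /=.
  by case: eqP => [->|_]; rewrite ?mulr1 ?mul1r ?mulr0 ?mul0r.
apply/eqP => /(congr1 (mulmx^~ (invmx P))).
rewrite mulmxK ?spectral_unit // mul0mx => /rowP /(_ i); rewrite !mxE !eqxx /=.
by move/eqP; rewrite oner_eq0.
Qed.

Let eigenE a : eigenvalue A a -> exists i, a = D 0 i.
Proof.
case/eigenvalueP => v vA v0; pose w := v *m invmx P.
have w0 : w != 0.
  apply: contra v0 => /eqP w0; have := mulmxKV (spectral_unit A) v.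
  by rewrite -/P -/w w0 mul0mx => <-.
have wD : w *m diag_mx D = a *: w.
  rewrite /w scalemxAl -vA {1}AE !mulmxA.
  by rewrite -[in RHS]mulmxA mulmxV ?spectral_unit // mulmx1.
have [i wi] : exists i, w 0 i != 0.
  apply/existsP; apply: contraR w0; rewrite negb_exists => /forallP w0.
  by apply/eqP/rowP => i; rewrite [RHS]mxE; apply/eqP/negbNE/w0.
exists i; move/rowP: wD => /(_ i); rewrite mul_mx_diag mxE [RHS]mxE mulrC.
by move/(mulIf wi).
Qed.

(** The infimum and supremum that define the extremal eigenvalues are over a
    bounded set, because every eigenvalue is an entry of the spectral diagonal. *)
Lemma eigenvalue_bounds i :
  min_eigenvalue A <= complex.Re (D 0 i) <= max_eigenvalue A.
Proof.
pose m : R := \sum_i `|complex.Re (D 0 i)|.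
have bnd a : eigenvalue A a%:C%C -> `|a| <= m.
  move=> /eigenE [j]; rewrite DE => -[->].
  rewrite /m (bigD1 j) //= lerDl; exact: sumr_ge0.
have Ei : eigenvalue A (complex.Re (D 0 i))%:C%C by rewrite -DE.
apply/andP; split.
  apply: ge_inf => //; exists (- m) => a /bnd; rewrite ler_norml => /andP[//].
apply: ub_le_sup => //; exists m => a /bnd; rewrite ler_norml => /andP[//].
Qed.

(** In an orthonormal basis of eigenvectors the form is the average of the
    eigenvalues with weights the square moduli of the coordinates of w. *)
Lemma rayleigh (w : 'cV[C]_n) : exists2 r : R,
  ((map_mx (@Num.conj C) w)^T *m A *m w) 0 0 = r%:C%C &
  min_eigenvalue A * (\sum_i sqn (w i 0)) <= r <=
  max_eigenvalue A * (\sum_i sqn (w i 0)).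
Proof.
pose v := P *m w.
have Pu : P \is unitarymx by exact: spectral_unitarymx.
have vE : (map_mx (@Num.conj C) v)^T = (map_mx (@Num.conj C) w)^T *m invmx P.
  by rewrite /v invmx_unitary // map_mxM trmx_mul -map_trmx.
have nE : \sum_i sqn (v i 0) = \sum_i sqn (w i 0).
  apply: complexI; rewrite -!colnormE vE /v -!mulmxA; congr ((_ *m _) 0 0).
  by rewrite mulmxA mulVmx ?spectral_unit // mul1mx.
exists (\sum_i complex.Re (D 0 i) * sqn (v i 0)).
  rewrite {1}AE !mulmxA -vE -mulmxA -/v mul_mx_diag mxE rmorph_sum /=.
  apply: eq_bigr => i _; rewrite rmorphM /= sqnC -DE.
  have -> (M : 'rV[C]_n) : (\matrix_(i0, j) (M i0 j * D 0 j)) 0 i = M 0 i * D 0 i.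
    by rewrite mxE.
  rewrite mxE [X in X * _ * _]mxE mulrAC [in RHS]mulrC; congr (_ * _).
  by rewrite mulrC.
rewrite -nE !mulr_sumr.
have sq0 i : 0 <= sqn (v i 0) by rewrite addr_ge0 // sqr_ge0.
by apply/andP; split; apply: ler_sum => i _; apply: ler_wpM2r => //;
  case/andP: (eigenvalue_bounds i).
Qed.

End Rayleigh.

Lemma gram_bounds n (A : 'M[C]_n) (w : 'cV[C]_n) :
  min_eigenvalue (gram A) * (\sum_i sqn (w i 0)) <=
    \sum_i sqn ((A *m w) i 0) <=
  max_eigenvalue (gram A) * (\sum_i sqn (w i 0)).
Proof.
have [r rE] := rayleigh (gram_hermsym A) w.
suff -> : r = \sum_i sqn ((A *m w) i 0) by [].
apply: complexI; rewrite -rE -colnormE map_mxM trmx_mul /gram.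
by rewrite !mulmxA.
Qed.

Lemma sum_sqn_mxcol q N (B : 'I_q -> 'cV[C]_N) :
  \sum_i sqn ((\mxcol_(r < q) B r) i 0) = \sum_(r < q) \sum_(l < N) sqn (B r l 0).
Proof.
apply: complexI; rewrite -colnormE rmorph_sum /=.
have -> : (map_mx (@Num.conj C) (\mxcol_(r < q) B r))^T =
   \mxrow_(r < q) (map_mx (@Num.conj C) (B r))^T.
  by rewrite -tr_mxcol; congr trmx; apply/matrixP => i j; rewrite !mxE.
rewrite mul_mxrow_mxcol summxE; apply: eq_bigr => r _.
by rewrite -colnormE.
Qed.

(** The Rayleigh bounds for H(xi), with the block structure written out. *)
Lemma H_matrix_bounds {K : fieldType} (q N : nat) (varpi : K)
    (un : nat -> K) (h : 'I_q -> 'I_N -> 'I_N -> K -> C) (xi : K)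
    (w : 'I_q -> 'I_N -> C) (G := gram (H_matrix varpi un h xi))
    (Sw := \sum_(s < q) \sum_(j < N) sqn (w s j))
    (Tw := \sum_(r < q) \sum_(l < N)
      sqn (\sum_(s < q) \sum_(j < N) h r l j (xi + varpi * un s) * w s j)) :
  min_eigenvalue G * Sw <= Tw <= max_eigenvalue G * Sw.
Proof.
pose W := \mxcol_(s < q) (\col_(j < N) w s j).
have SE : Sw = \sum_i sqn (W i 0).
  rewrite /W sum_sqn_mxcol; apply: eq_bigr => s _; apply: eq_bigr => j _.
  by rewrite mxE.
have TE : Tw = \sum_i sqn ((H_matrix varpi un h xi *m W) i 0).
  rewrite /H_matrix mul_mxblock_mxrow sum_sqn_mxcol.
  apply: eq_bigr => r _; apply: eq_bigr => l _; congr sqn.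
  rewrite summxE; apply: eq_bigr => s _; rewrite mxE; apply: eq_bigr => j _.
  by rewrite !mxE.
rewrite SE TE; exact: gram_bounds.
Qed.

End Spectral.

(** * Borel sets and compact sets of a local field *)

Section Topology.
Context {K : topologicalFieldType}.
Implicit Types (A U V : set K) (a b x y : K).

Lemma open_borel A : open A -> measurable (A : set (borel K)).
Proof. by move=> oA; apply: sub_sigma_algebra. Qed.

Lemma closed_borel A : closed A -> measurable (A : set (borel K)).
Proof.
by move=> cA; rewrite -[A]setCK; apply: measurableC; apply: open_borel; exact: closed_openC.
Qed.

Lemma continuous_borel (f : K -> K) : continuous f ->
  measurable_fun [set: borel K] (f : borel K -> borel K).
Proof.
move=> /continuousP cf; 
apply: (@measurability _ _ (borel K) (borel K) setT f (@open K)) => //.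
by move=> _ [U oU <-]; rewrite setTI; apply: open_borel; exact: cf.
Qed.

Lemma continuous_borel_real {R : realType} (f : K -> R) : continuous f ->
  measurable_fun [set: borel K] (f : borel K -> R).
Proof.
move=> /continuousP cf; apply: (measurability _ (RGenOpens.measurableE R)) => //.
move=> _ [_ [a [b ->] <-]]; rewrite setTI.
by apply: open_borel; apply: cf; exact: interval_open.
Qed.

Lemma addl_continuous a : continuous (fun x : K => a + x).
Proof.
move=> x.
apply: (@cvg_comp K (K * K)%type K (fun y => (a, y)) (fun z => z.1 + z.2) _
  (nbhs (a, x)) _); last exact: (@add_continuous K (a, x)).
by apply: cvg_pair => //; exact: cvg_cst.
Qed.

Lemma mull_continuous a : continuous (fun x : K => a * x).
Proof.
move=> x.
apply: (@cvg_comp K (K * K)%type K (fun y => (a, y)) (fun z => z.1 * z.2) _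
  (nbhs (a, x)) _); last exact: (@topfield_mul_continuous K (a, x)).
by apply: cvg_pair => //; exact: cvg_cst.
Qed.

Lemma image_addlE a A : [set a + x | x in A] = (fun x => - a + x) @^-1` A.
Proof.
apply/seteqP; split => [_ [x Ax <-]|x Ax] /=; first by rewrite addKr.
by exists (- a + x) => //; rewrite addNKr.
Qed.

Lemma image_mullE a A : a != 0 ->
  [set a * x | x in A] = (fun x => a^-1 * x) @^-1` A.
Proof.
move=> a0; apply/seteqP; split => [_ [x Ax <-]|x Ax] /=; first by rewrite mulKf.
by exists (a^-1 * x) => //; rewrite mulVKf.
Qed.

Lemma measurable_image_addl a A : measurable (A : set (borel K)) ->
  measurable ([set a + x | x in A] : set (borel K)).
Proof.
move=> mA; rewrite image_addlE -[X in measurable X]setTI.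
by apply: continuous_borel => //; exact: addl_continuous.
Qed.

Lemma measurable_image_mull a A : a != 0 -> measurable (A : set (borel K)) ->
  measurable ([set a * x | x in A] : set (borel K)).
Proof.
move=> a0 mA; rewrite image_mullE // -[X in measurable X]setTI.
by apply: continuous_borel => //; exact: mull_continuous.
Qed.

(** The tube lemma for multiplication on a compact set. *)
Lemma image_mull_near V U a : compact V -> open U ->
  (forall x, V x -> U (a * x)) -> \forall b \near a, forall x, V x -> U (b * x).
Proof.
move=> /compact_near_coveringP Vc oU aVU.
apply: (Vc K (nbhs a) (fun b x => U (b * x))) => x Vx.
have := @topfield_mul_continuous K (a, x) _ (open_nbhs_nbhs (conj oU (aVU x Vx))).
move=> [[P Q] /= [Pa Qx] PQ]; exists (Q, P) => //= -[y b] /= [Qy Pb].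
exact: (PQ (b, y)).
Qed.

Lemma compact_bounded {R : realType} (g : K -> R) A : compact A ->
  (forall x, A x -> exists M, \forall y \near x, g y < M) ->
  exists M, forall x, A x -> g x < M.
Proof.
move=> /compact_near_coveringP Ac gA.
have [|n _ nP] := Ac nat \oo (fun n y => g y < n%:R) _.
  move=> x /gA [M Mx]; have [m mM] : exists m : nat, M < m%:R.
    by exists (Num.bound `|M|); rewrite (le_lt_trans (ler_norm _)) // archi_boundP.
  exists ([set y | g y < M], [set n | (m <= n)%N]) => /=.
    by split => //; exists m.
  move=> [y n] /= [yM mn]; apply: (lt_trans yM); apply: (lt_le_trans mM).
  by rewrite ler_nat.
by exists n%:R => x Ax; exact: (nP n (leqnn n)).
Qed.

Hypothesis Kl : local_field K.

Lemma compact_nbhs0 : exists V : set K, compact V /\ nbhs 0 V.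
Proof.
have := local_field_locally_compact Kl (I : [set: K] 0).
move=> [V VN [cV _]]; exists V; split => //.
by apply: (@filterS _ (nbhs (0:K)) _ _ _ _ VN) => x; exact.
Qed.

(** This is where nondiscreteness enters. *)
Lemma near0_neq0 (P : K -> Prop) : (\forall b \near 0, P b) ->
  exists2 b, b != 0 & P b.
Proof.
move=> P0; apply: contrapT => nP; apply: (local_field_nondiscrete Kl).
rewrite openE => x ->; apply: filterS P0 => b Pb /=.
by apply/eqP/negPn/negP => b0; apply: nP; exists b.
Qed.

Lemma compact_borel V : compact V -> measurable (V : set (borel K)).
Proof.
by move=> cV; apply: closed_borel; apply: compact_closed => //; case: Kl.
Qed.

End Topology.

(** * The Haar modulus *)

Section HaarModulus.
Context {R : realType} {K : topologicalFieldType}.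
Variables (mu : {measure set (borel K) -> \bar R}) (abs : K -> R).
Hypotheses (Kl : local_field K) (muH : haar_measure mu)
  (absH : haar_modulus mu abs).
Implicit Types (A U V : set K) (a b x y : K).

(** If V were null then so would be every compact set, being covered by
    finitely many translates of the interior of V; by inner regularity K would
    be null. *)
Lemma haar_nbhs0_gt0 V : compact V -> nbhs 0 V -> (0 < mu V)%E.
Proof.
move=> cV V0; rewrite lt0e measure_ge0 andbT; apply/eqP => muV.
suff : mu [set: K] = 0 by move=> T0; have := haar_neq0 muH; rewrite T0 ltxx.
have [U [oU U0] UV] : exists2 U : set K, open_nbhs 0 U & U `<=` V.
  by move: V0; rewrite nbhsE.
have muU : mu U = 0%E.
  apply/eqP; rewrite -measure_le0 -muV le_measure // inE.
    exact: open_borel.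
  exact: compact_borel.
rewrite (haar_inner_regular muH openT); apply/eqP.
rewrite eq_le; apply/andP; split; last first.
  apply: ereal_sup_ubound; exists set0; last by rewrite measure0.
  by split => //; exact: compact0.
apply: ge_ereal_sup => _ [C [cC _] <-].
have mtU a : measurable ([set a + x | x in U] : set (borel K)).
  by apply: measurable_image_addl; exact: open_borel.
have : cover_compact C by rewrite -(compact_cover K).
move=> /(_ K setT (fun a => [set a + x | x in U])) [].
- move=> a _; rewrite image_addlE.
  by move/continuousP: (@addl_continuous K (- a)); exact.
- by move=> x _; exists x => //; exists 0; rewrite ?addr0.
move=> D' _; rewrite /cover => Cc.
have := content_sub_fsum mu (finite_fset D') _ (compact_borel Kl cC) Cc.
move=> /(_ (fun a _ => mtU a)) /le_trans; apply.
rewrite fsbig1 // => a _.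
by apply: etrans (haar_translation muH a _) muU; exact: open_borel.
Qed.

(** If {0} had mass m > 0 then, by outer regularity, some open neighbourhood of
    0 would have mass less than 2m; by translation invariance it would contain
    no other point, and {0} would be open. *)
Lemma haar_set0 : mu [set (0 : K)] = 0%E.
Proof.
have m1 x : measurable ([set x] : set (borel K)).
  by apply: compact_borel => //; exact: compact_set1.
have fin := haar_compact muH (@compact_set1 K 0).
apply/eqP/negPn/negP => m0.
have mgt0 : (0 < mu [set (0%R : K)])%E by rewrite lt0e m0 measure_ge0.
pose m := fine (mu [set (0%R : K)]).
have mE : mu [set (0%R : K)] = m%:E by rewrite fineK // ge0_fin_numE // measure_ge0.
have mp : 0 < m by rewrite -lte_fin -mE.
have : (mu [set (0%R : K)] < (m + m)%:E)%E by rewrite mE lte_fin; lra.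
rewrite {1}(haar_outer_regular muH (m1 0)) => /ereal_inf_lt [_ [U [oU U0] <-]] lt.
have [x x0 Ux] : exists2 b : K, b != 0 & U b.
  by apply: near0_neq0 => //; apply: open_nbhs_nbhs; split => //; exact: U0.
have : (mu ([set (0%R : K)] `|` [set x]) <= mu U)%E.
  apply: le_measure; rewrite ?inE; [exact: measurableU|exact: open_borel|].
  by move=> y [->|->] //; exact: U0.
rewrite measureU //; last first.
  apply/seteqP; split => // y [/= -> x0']; move: x0.
  by rewrite -x0' eqxx.
have e : mu [set x] = m%:E.
  have := haar_translation muH x (m1 0); rewrite mE => <-.
  by rewrite image_set1 addr0.
by move=> /le_lt_trans /(_ lt); rewrite [X in (X + _ < _)%E]mE [X in (_ + X < _)%E]e ltxx.
Qed.

Lemma abs0 : abs 0 = 0. Proof. by case: absH. Qed.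

Section Scaling.
Variable V : set K.
Hypotheses (cV : compact V) (V0 : nbhs 0 V).

Let mV : measurable (V : set (borel K)). Proof. exact: compact_borel. Qed.

Let v : R := fine (mu V).

Let muVE : mu V = v%:E.
Proof.
by rewrite fineK // ge0_fin_numE ?measure_ge0 // (haar_compact muH).
Qed.

Let v0 : 0 < v. Proof. by rewrite -lte_fin -muVE haar_nbhs0_gt0. Qed.

Let mu_scale a : mu [set a * x | x in V] = (abs a * v)%:E.
Proof.
have [->|a0] := eqVneq a 0.
  rewrite abs0 mul0r; apply: etrans haar_set0.
  suff -> : [set 0 * x | x in V] = [set 0] by []; apply/seteqP; split.
    by move=> _ [x _ <-]; rewrite mul0r.
  by move=> _ ->; exists 0; rewrite ?mul0r //; exact: nbhs_singleton.
by rewrite EFinM -muVE; case: absH => _; exact.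
Qed.

Lemma abs_ge0_subproof a : 0 <= abs a.
Proof.
have : (0 <= mu [set (a * x)%R | x in V])%E by exact: measure_ge0.
by rewrite mu_scale lee_fin pmulr_lge0.
Qed.

Lemma absM_subproof a b : abs (a * b) = abs a * abs b.
Proof.
have [->|a0] := eqVneq a 0; first by rewrite mul0r abs0 mul0r.
have [->|b0] := eqVneq b 0; first by rewrite mulr0 abs0 mulr0.
have : mu [set a * b * x | x in V] = mu [set a * x | x in [set b * x | x in V]].
  suff -> : [set a * b * x | x in V] = [set a * x | x in [set b * x | x in V]] by [].
  rewrite image_comp; congr (_ @` _).
  by apply/funext => x /=; rewrite mulrA.
case: absH => _ /(_ a _ a0 (measurable_image_mull b0 mV)) ->.
rewrite !mu_scale -EFinM => -[/eqP]; rewrite mulrA.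
by rewrite (inj_eq (mulIf (lt0r_neq0 v0))) => /eqP.
Qed.

(** |b| is the factor by which multiplication by b scales the mass of a compact
    neighbourhood V of 0. Outer regularity encloses a V in an open set of
    nearly the same mass, and b V lies in that set for b near a. *)
Lemma abs_usc_subproof a t : abs a < t -> \forall b \near a, abs b < t.
Proof.
move=> lt; have t0 : 0 < t := le_lt_trans (abs_ge0_subproof a) lt.
have maV : measurable ([set a * x | x in V] : set (borel K)).
  have [->|a0] := eqVneq a 0; last exact: measurable_image_mull.
  rewrite (_ : [set _ | _ in _] = [set 0]).
    by apply: compact_borel => //; exact: compact_set1.
  apply/seteqP; split; first by move=> _ [x _ <-]; rewrite mul0r.
  by move=> _ ->; exists 0; rewrite ?mul0r //; exact: nbhs_singleton.
have : (mu [set (a * x)%R | x in V] < (t * v)%:E)%E by rewrite mu_scale lte_fin ltr_pM2r.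
rewrite (haar_outer_regular muH maV) => /ereal_inf_lt [_ [U [oU aU] <-]] ltU.
have : forall x, V x -> U (a * x) by move=> x Vx; apply: aU; exists x.
move=> /(image_mull_near cV oU); apply: filterS => b bU.
have [->|b0] := eqVneq b 0; first by rewrite abs0.
have : (mu [set (b * x)%R | x in V] < (t * v)%:E)%E.
  apply: le_lt_trans ltU; apply: le_measure; rewrite ?inE.
  - exact: measurable_image_mull.
  - exact: open_borel.
  - by move=> _ [x Vx <-]; exact: bU.
by rewrite mu_scale lte_fin ltr_pM2r.
Qed.

End Scaling.

Let V_ex := compact_nbhs0 Kl.

Lemma abs_ge0 a : 0 <= abs a.
Proof. by case: V_ex => V [cV V0]; exact: abs_ge0_subproof cV V0 _. Qed.

Lemma absM a b : abs (a * b) = abs a * abs b.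
Proof. by case: V_ex => V [cV V0]; exact: absM_subproof cV V0 _ _. Qed.

Lemma abs_usc a t : abs a < t -> \forall b \near a, abs b < t.
Proof. by case: V_ex => V [cV V0]; exact: abs_usc_subproof cV V0 _ _. Qed.

Lemma abs1 : abs 1 = 1.
Proof.
have [V [cV V0]] := V_ex; have := @haar_nbhs0_gt0 V cV V0 => V_gt0.
have : (mu [set (1 * x)%R | x in V] = (abs 1)%:E * mu V)%E.
  by case: absH => _; apply; rewrite ?oner_neq0 //; exact: compact_borel.
have -> : [set 1 * x | x in V] = V.
  apply/seteqP; split => [_ [x Vx <-]|x Vx]; first by rewrite mul1r.
  by exists x; rewrite ?mul1r.
have := haar_compact muH cV.
move: (mu V) V_gt0 => [v| |] //; rewrite lte_fin => v0 _ [] /eqP.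
by rewrite eq_sym -[X in _ == X]mul1r (inj_eq (mulIf (lt0r_neq0 v0))) => /eqP.
Qed.

Lemma absX a n : abs (a ^+ n) = abs a ^+ n.
Proof. by elim: n => [|n IH]; rewrite ?expr0 ?abs1 // !exprS absM IH. Qed.

Lemma abs_neq0 a : a != 0 -> abs a != 0.
Proof.
move=> a0; apply/eqP => e; have := absM a a^-1.
by rewrite divff // abs1 e mul0r; apply/eqP; rewrite oner_eq0.
Qed.

Lemma abs_gt0 a : a != 0 -> 0 < abs a.
Proof. by move=> a0; rewrite lt0r abs_neq0 // abs_ge0. Qed.

Lemma absV a : abs a^-1 = (abs a)^-1.
Proof.
have [->|a0] := eqVneq a 0; first by rewrite invr0 abs0 invr0.
by apply: (mulfI (abs_neq0 a0)); rewrite -absM !divff ?abs1 ?abs_neq0.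
Qed.

Lemma absN a : abs (- a) = abs a.
Proof.
rewrite -mulN1r absM; suff -> : abs (-1) = 1 by rewrite mul1r.
apply/eqP; rewrite -(@eqrXn2 _ 2) // ?abs_ge0 // expr1n -absX.
by rewrite sqrrN expr1n abs1.
Qed.

(** The powers of such an r serve to compare |.| with the topology near 0. *)
Lemma abs_contraction V : compact V -> nbhs 0 V ->
  exists r, [/\ r != 0, abs r < 1 & forall x, V x -> V (r * x)].
Proof.
move=> cV V0.
have [U [oU U0] UV] : exists2 U : set K, open_nbhs 0 U & U `<=` V.
  by move: V0; rewrite nbhsE.
have [r r0 [r1 rV]] : exists2 r : K, r != 0 & abs r < 1 /\ forall x, V x -> U (r * x).
  apply: near0_neq0 => //; near=> b; split.
    by near: b; apply: abs_usc; rewrite abs0.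
  near: b; apply: image_mull_near => // x _; by rewrite mul0r.
by exists r; split => // x /rV /UV.
Unshelve. all: by end_near. Qed.

End HaarModulus.

(** * The ring of integers is an open ring *)

Section Ultrametric.
Context {R : realType} {K : topologicalFieldType}.
Variables (mu : {measure set (borel K) -> \bar R}) (abs : K -> R).
Hypotheses (Kl : local_field K) (muH : haar_measure mu)
  (absH : haar_modulus mu abs).
Implicit Types (A U V : set K) (a b x y : K).

Let absM := absM Kl muH absH.
Let absX := absX Kl muH absH.
Let absV := absV Kl muH absH.
Let abs_gt0 := abs_gt0 Kl muH absH.
Let abs_ge0 := abs_ge0 Kl muH absH.
Let abs_usc := abs_usc Kl muH absH.

Lemma compact_abs_bounded A : compact A -> exists M, forall x, A x -> abs x < M.
Proof.
move=> cA; apply: (compact_bounded cA) => x _; exists (abs x + 1).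
by apply: abs_usc; rewrite ltrDl.
Qed.

Lemma compact_absV_bounded A : compact A -> ~ A 0 ->
  exists2 M, 0 < M & forall x, A x -> (abs x)^-1 < M.
Proof.
move=> cA A0; have [|M AM] := @compact_bounded K R (fun x => abs x^-1) A cA.
  move=> x Ax; have x0 : x != 0 by apply: contra_notN A0 => /eqP <-.
  exists (abs x^-1 + 1).
  apply: (topfield_inv_continuous x x0 [set z | abs z < abs x^-1 + 1]).
  by apply: abs_usc; rewrite ltrDl.
exists (`|M| + 1); first by rewrite ltr_wpDl.
by move=> x /AM; rewrite absV => /lt_le_trans; apply; rewrite ler_wpDr // ler_norm.
Qed.

Lemma expr_lt_eventually (t e : R) : 0 <= t < 1 -> 0 < e -> exists n, t ^+ n < e.
Proof.
case/andP => t0 t1 e0; have := @cvg_expr R t.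
rewrite ger0_norm // => /(_ t1) /cvgr_lt /(_ e e0) [n _ nP].
by exists n; exact: (nP n (leqnn n)).
Qed.

Section Contraction.
Variables (V : set K) (r : K).
Hypotheses (cV : compact V) (V0 : nbhs 0 V) (r0 : r != 0) (r1 : abs r < 1)
  (rV : forall x, V x -> V (r * x)).

Let r01 : 0 <= abs r < 1. Proof. by rewrite abs_ge0. Qed.

Let expr_r_V n x : V x -> V (r ^+ n * x).
Proof. by move=> Vx; elim: n => [|n IH]; rewrite ?mul1r // exprS -mulrA; exact: rV. Qed.

(** Outside a neighbourhood U of 0 the compact set V has |.| bounded below,
    whereas |r^n s| tends to 0 for a nonzero s in V; so r^n s is in U for some
    n, and U may be chosen so that multiplication by x/s maps it into V. *)
Lemma contraction_absorbs x : exists n, V (r ^+ n * x).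
Proof.
have [s s0 Vs] : exists2 b : K, b != 0 & V b by exact: near0_neq0.
have : \forall b \near 0, V (b * (s^-1 * x)).
  have : nbhs ((s^-1 * x) * 0) V by rewrite mulr0.
  move=> /(@mull_continuous K (s^-1 * x) 0).
  apply: (@filterS _ (nbhs (0 : K))) => b /=.
  by rewrite mulrC.
rewrite -nbhs_nearE nbhsE => -[U [oU U0] UV].
have [M M0 MP] : exists2 M, 0 < M & forall y, (V `&` ~` U) y -> (abs y)^-1 < M.
  apply: compact_absV_bounded; last by case.
  by apply: compact_closedI => //; exact: open_closedC.
have [n rn] : exists n, abs r ^+ n < (abs s * M)^-1.
  by apply: expr_lt_eventually => //; rewrite invr_gt0 mulr_gt0 // abs_gt0.
exists n; suff : U (r ^+ n * s) by move/UV => /=; rewrite mulrA mulfK.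
apply: contrapT => nU; have := MP _ (conj (expr_r_V n Vs) nU).
apply/negP; rewrite -leNgt absM absX -div1r.
rewrite ler_pdivlMr ?mulr_gt0 ?exprn_gt0 ?abs_gt0 //.
move: rn; rewrite -div1r ltr_pdivlMr ?mulr_gt0 ?abs_gt0 // => /ltW.
by rewrite mulrCA mulrC mulrA [_ * M]mulrC mulrC mulrA.
Qed.

(** Let x lie outside V and n be the least exponent with r^n x in V. Then r^n x
    is in V but not in r V, a set on which |.| is bounded below, and |x| >=
    |r^n x|. So |.| defines the topology at 0. *)
Lemma small_abs_subset : exists2 d, 0 < d & forall x, abs x <= d -> V x.
Proof.
have : nbhs (r * 0) [set r * x | x in V].
  have : nbhs (r^-1 * (r * 0)) V by rewrite !mulr0.
  move=> /(@mull_continuous K r^-1 (r * 0)).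
  apply: (@filterS _ (nbhs (r * 0))) => y /= Vy.
  by exists (r^-1 * y) => //; rewrite mulVKf.
rewrite mulr0 nbhsE => -[U [oU U0] UV].
have [M M0 MP] : exists2 M, 0 < M & forall y, (V `&` ~` U) y -> (abs y)^-1 < M.
  apply: compact_absV_bounded; last by case.
  by apply: compact_closedI => //; exact: open_closedC.
exists M^-1; first by rewrite invr_gt0.
move=> x xM; apply: contrapT => nVx.
have ex : exists n, `[< V (r ^+ n * x) >].
  by have [n nP] := contraction_absorbs x; exists n; exact/asboolP.
case: (ex_minnP ex) => -[|n] /asboolP Vn minn.
  by apply: nVx; move: Vn; rewrite mul1r.
have nU : ~ U (r ^+ n.+1 * x).
  move=> /UV [y Vy]; rewrite exprS -mulrA => /(mulfI r0) yE.
  have /minn : `[< V (r ^+ n * x) >] by apply/asboolP; rewrite -yE.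
  by rewrite ltnn.
have := MP _ (conj Vn nU); apply/negP; rewrite -leNgt.
rewrite -[leLHS]invrK lef_pV2 ?posrE ?invr_gt0 ?abs_gt0 //; last first.
  rewrite mulf_neq0 ?expf_neq0 //; apply/eqP => x0; apply: nVx.
  by rewrite x0; exact: nbhs_singleton.
apply: le_trans xM; rewrite absM absX ler_piMl // ?abs_ge0 //.
by rewrite exprn_ile1 // ?abs_ge0 // ltW.
Qed.

End Contraction.

(** A power of r maps the ring of integers into V, hence sums of integers into
    the compact set V + V. *)
Lemma int_ring_sum_bounded : exists M, forall x y,
  int_ring abs x -> int_ring abs y -> abs (x + y) < M.
Proof.
have [V [cV V0]] := compact_nbhs0 Kl.
have [r [r0 r1 rV]] := abs_contraction Kl muH absH cV V0.
have [d d0 dV] := small_abs_subset cV V0 r0 r1 rV.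
have [n rn] : exists n, abs r ^+ n < d.
  by apply: expr_lt_eventually => //; rewrite abs_ge0.
have DV x : int_ring abs x -> V (r ^+ n * x).
  move=> xD; apply: dV; rewrite absM absX; apply: le_trans (ltW rn).
  by rewrite ler_piMr // exprn_ge0 // abs_ge0.
have cVV : compact [set z.1 + z.2 | z in V `*` V].
  apply: continuous_compact; last exact: compact_setX.
  by apply: continuous_subspaceT => z; exact: (@add_continuous K z).
have [M MP] := compact_abs_bounded cVV.
have rn0 : 0 < abs r ^+ n by rewrite exprn_gt0 // abs_gt0.
exists (M / abs r ^+ n) => x y xD yD.
rewrite ltr_pdivlMr // -absX -absM; apply: MP.
exists (r ^+ n * x, r ^+ n * y) => /=; first by split; exact: DV.
by rewrite mulrDl ![_ * r ^+ n]mulrC.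
Qed.

Variables (p : nat) (pK : p \in [pchar K]).

(** The bound on sums of integers holds for x^(p^n) + y^(p^n), which by
    Frobenius is (x + y)^(p^n); a bounded sequence of powers of |x + y| has |x
    + y| <= 1. *)
Lemma int_ringD x y : int_ring abs x -> int_ring abs y -> int_ring abs (x + y).
Proof.
move=> xD yD; have [M MP] := int_ring_sum_bounded.
rewrite /int_ring /= leNgt; apply/negP => xy1.
have p_gt1 : (1 < p)%N by rewrite prime_gt1 // (pcharf_prime pK).
have le n : abs (x + y) ^+ (p ^ n) < M.
  have pn : [pchar K].-nat (p ^ n)%N.
    by rewrite pnatX pnatE ?(pcharf_prime pK) // pK.
  rewrite -absX exprDn_pchar //; apply: MP; rewrite /int_ring /= absX;
  by rewrite exprn_ile1 // abs_ge0.
have M0 : 0 < M by apply: le_lt_trans (le 0%N); rewrite exprn_ge0 // abs_ge0.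
have t1 : 0 <= (abs (x + y))^-1 < 1.
  by rewrite invr_ge0 abs_ge0 invf_lt1 // (lt_trans ltr01).
have [|n] := @expr_lt_eventually _ M^-1 t1; first by rewrite invr_gt0.
rewrite exprVn ltf_pV2 ?posrE ?exprn_gt0 ?(lt_trans ltr01 xy1) // => Mn.
suff : M < M by rewrite ltxx.
apply: (lt_trans Mn); apply: le_lt_trans (le n).
by apply: ler_weXn2l; [exact: ltW|exact/ltnW/ltn_expl].
Qed.

Lemma int_ringN x : int_ring abs x -> int_ring abs (- x).
Proof. by rewrite /int_ring /= (absN Kl muH absH). Qed.

Lemma int_ringM x y : int_ring abs x -> int_ring abs y -> int_ring abs (x * y).
Proof. by rewrite /int_ring /= absM => ? ?; rewrite mulr_ile1 ?abs_ge0. Qed.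

Lemma int_ring0 : int_ring abs 0.
Proof. by rewrite /int_ring /= (abs0 absH) ler01. Qed.

Lemma int_ring1 : int_ring abs 1.
Proof. by rewrite /int_ring /= (abs1 Kl muH absH). Qed.

Lemma int_ringX x n : int_ring abs x -> int_ring abs (x ^+ n).
Proof. by move=> xD; rewrite /int_ring /= absX exprn_ile1 // abs_ge0. Qed.

Lemma int_ring_open : open (int_ring abs).
Proof.
rewrite openE => x xD; have : nbhs (- x + x) [set z | abs z < 1].
  by rewrite addNr; apply: abs_usc; rewrite (abs0 absH).
move=> /(@addl_continuous K (- x) x).
apply: (@filterS _ (nbhs x)) => y /= yx.
by rewrite -[y](addNKr x); apply: int_ringD => //=; exact: ltW.
Qed.

(** A prime element is at least as large as any nonzero element of modulus less
    than 1, and such elements exist because |.| is upper semicontinuous at 0. *)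
Lemma prime_element_neq0 varpi : prime_element abs varpi -> varpi != 0.
Proof.
case=> _ vmax; have [r r0 r1] : exists2 r : K, r != 0 & abs r < 1.
  by apply: near0_neq0 => //; apply: abs_usc; rewrite (abs0 absH).
apply/eqP => v0; have := vmax r r1; rewrite v0 (abs0 absH).
by apply/negP; rewrite -ltNge abs_gt0.
Qed.

End Ultrametric.

(** * Complex-valued integrals *)

Section ComplexIntegral.
Context d {T : measurableType d} {R : realType}.
Variable mu : {measure set T -> \bar R}.
Local Notation C := R[i].
Implicit Types (f g : T -> C) (A : set T).

Definition cmeas A f :=
  measurable_fun A (fun x => complex.Re (f x)) /\
  measurable_fun A (fun x => complex.Im (f x)).

Definition cintegrable A f :=
  mu.-integrable A (EFin \o (fun x => complex.Re (f x))) /\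
  mu.-integrable A (EFin \o (fun x => complex.Im (f x))).

Definition cint A f : C :=
  ((\int[mu]_(x in A) complex.Re (f x)) +i* (\int[mu]_(x in A) complex.Im (f x)))%C.

Lemma cmeas_cst A c : cmeas A (fun=> c).
Proof. by split; exact: measurable_cst. Qed.

Lemma cmeasD A f g : cmeas A f -> cmeas A g -> cmeas A (fun x => f x + g x).
Proof.
move=> [fr fi] [gr gi]; split.
  by under eq_fun do rewrite ReD; exact: measurable_funD.
by under eq_fun do rewrite ImD; exact: measurable_funD.
Qed.

Lemma cmeasM A f g : cmeas A f -> cmeas A g -> cmeas A (fun x => f x * g x).
Proof.
move=> [fr fi] [gr gi]; split.
  by under eq_fun do rewrite ReM; apply: measurable_funB; exact: measurable_funM.
by under eq_fun do rewrite ImM; apply: measurable_funD; exact: measurable_funM.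
Qed.

Lemma cmeasJ A f : cmeas A f -> cmeas A (fun x => (f x)^*).
Proof.
move=> [fr fi]; split; first by under eq_fun do rewrite ReJ.
by under eq_fun do rewrite ImJ; exact: measurableT_comp.
Qed.

Lemma cmeas_sqn A f : cmeas A f -> measurable_fun A (fun x => sqn (f x)).
Proof. by move=> [fr fi]; apply: measurable_funD; exact: measurable_funX. Qed.

Lemma cmeas_sqmod A f : cmeas A f -> measurable_fun A (fun x => sqmod (f x)).
Proof. by move=> /cmeas_sqn mf; apply/measurable_EFinP. Qed.

Lemma cmeasS A B f : measurable B -> A `<=` B -> cmeas B f -> cmeas A f.
Proof. by move=> mB AB [fr fi]; split; exact: measurable_funS AB _. Qed.

Section Domain.
Variables (A : set T).
Hypothesis mA : measurable A.

(** Both parts of f are dominated by F when |f|^2 <= F^2. *)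
Lemma cintegrable_le f (F : T -> R) : cmeas A f ->
  mu.-integrable A (EFin \o F) -> (forall x, A x -> sqn (f x) <= F x ^+ 2) ->
  cintegrable A f.
Proof.
move=> [mr mi] iF fF; split.
- apply: (le_integrable mA _ _ iF); first exact/measurable_EFinP.
  move=> x Ax /=; rewrite lee_fin -[leLHS]sqrtr_sqr -[leRHS]sqrtr_sqr ler_wsqrtr //.
  by apply: le_trans (fF x Ax); rewrite lerDl sqr_ge0.
- apply: (le_integrable mA _ _ iF); first exact/measurable_EFinP.
  move=> x Ax /=; rewrite lee_fin -[leLHS]sqrtr_sqr -[leRHS]sqrtr_sqr ler_wsqrtr //.
  by apply: le_trans (fF x Ax); rewrite lerDr sqr_ge0.
Qed.

Lemma cintD f g : cintegrable A f -> cintegrable A g ->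
  cint A (fun x => f x + g x) = cint A f + cint A g.
Proof.
move=> [fr fi] [gr gi]; apply: complexP; rewrite ?ReD ?ImD /=.
  by rewrite -RintegralD //; apply: eq_Rintegral => x _; rewrite ReD.
by rewrite -RintegralD //; apply: eq_Rintegral => x _; rewrite ImD.
Qed.

Let integrableZ (k : R) (F : T -> R) : mu.-integrable A (EFin \o F) ->
  mu.-integrable A (EFin \o (fun x => k * F x)).
Proof. by move=> iF; have := integrableZl mA k iF. Qed.

Lemma cintZ (a : C) f : cintegrable A f -> cint A (fun x => a * f x) = a * cint A f.
Proof.
move=> [fr fi]; apply: complexP; rewrite ?ReM ?ImM /=.
  rewrite -!RintegralZl // -RintegralB //; try exact: integrableZ.
  by apply: eq_Rintegral => x _; rewrite ReM.
rewrite -!RintegralZl // -RintegralD //; try exact: integrableZ.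
by apply: eq_Rintegral => x _; rewrite ImM.
Qed.

Lemma cintJ f : cintegrable A f -> cint A (fun x => (f x)^*) = (cint A f)^*.
Proof.
move=> [fr fi]; apply: complexP; rewrite ?ReJ ?ImJ /=.
  by apply: eq_Rintegral => x _; rewrite ReJ.
rewrite -mulN1r -RintegralZl //.
by apply: eq_Rintegral => x _; rewrite ImJ mulN1r.
Qed.

Lemma eq_cint f g : {in A, f =1 g} -> cint A f = cint A g.
Proof.
by move=> fg; congr Complex; apply: eq_Rintegral => x /fg ->.
Qed.

End Domain.
End ComplexIntegral.

(** * The inner product of square-integrable functions *)

Section L2Calculus.
Context {R : realType} {K : topologicalFieldType}.
Variable mu : {measure set (borel K) -> \bar R}.
Local Notation C := R[i].
Implicit Types (f g h : K -> C) (A : set K).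

Local Notation N2 := (sqnorm_on mu).
Local Notation cmeas := (@cmeas _ (borel K) R).
Local Notation cintegrable := (@cintegrable _ (borel K) R mu).

Definition nsq A f : R := fine (N2 A f).

(** The inner product of L^2(A); for A = K it is [inner] by definition. *)
Definition inner_on A f g : C := @cint _ (borel K) R mu A (fun x => f x * (g x)^*).

Lemma sqnorm_ge0 A f : (0 <= N2 A f)%E.
Proof. by apply: integral_ge0 => x _; rewrite lee_fin sqn_ge0. Qed.

Lemma nsq_ge0 A f : 0 <= nsq A f.
Proof. by rewrite fine_ge0 // sqnorm_ge0. Qed.

Section Domain.
Variable A : set K.
Hypothesis mA : measurable (A : set (borel K)).
Local Notation L2 := (L2_on mu A).
Local Notation nsq := (nsq A).
Local Notation inner := (inner_on A).

Lemma L2_cmeas f : L2 f -> cmeas A f. Proof. by case. Qed.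

Lemma sqnormE f : L2 f -> N2 A f = (nsq f)%:E.
Proof. by case=> _ _ fin; rewrite fineK // ge0_fin_numE // sqnorm_ge0. Qed.

Lemma sqnorm_le f (k1 k2 : R) g h : cmeas A f -> cmeas A g -> cmeas A h ->
  0 <= k1 -> 0 <= k2 ->
  (forall x, A x -> sqn (f x) <= k1 * sqn (g x) + k2 * sqn (h x)) ->
  (N2 A f <= k1%:E * N2 A g + k2%:E * N2 A h)%E.
Proof.
move=> mf mg mh k10 k20 le.
have e0 (k : R) u x : 0 <= k -> (0 <= k%:E * sqmod (u x : C))%E.
  by move=> k0; rewrite mule_ge0 // lee_fin // sqn_ge0.
have em (k : R) u : cmeas A u -> measurable_fun (A : set (borel K))
    (fun x : borel K => (k%:E * sqmod (u x))%E).
  move=> mu'; under eq_fun do rewrite -EFinM; apply/measurable_EFinP.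
  by apply: measurable_funM => //; exact: cmeas_sqn.
rewrite /sqnorm_on -!ge0_integralZl //; try exact: cmeas_sqmod;
  try by [move=> x _; rewrite lee_fin sqn_ge0|rewrite lee_fin].
rewrite -ge0_integralD //; try exact: em; try by move=> x _; exact: e0.
apply: ge0_le_integral.
- exact: mA.
- by move=> x _; rewrite lee_fin sqn_ge0.
- exact: cmeas_sqmod.
- by apply: emeasurable_funD; exact: em.
- by move=> x Ax; rewrite -!EFinM -EFinD lee_fin le.
Qed.

Lemma L20 : L2 (fun=> 0).
Proof.
have [mr mi] := @cmeas_cst _ (borel K) R A 0; split => //.
rewrite /sqnorm_on integral0_eq // => x _; by rewrite /sqmod -/(sqn _) sqn0.
Qed.

Lemma sqnorm0 : N2 A (fun=> 0) = 0%E.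
Proof. by rewrite /sqnorm_on integral0_eq // => x _; rewrite /sqmod -/(sqn _) sqn0. Qed.

Lemma L2D f g : L2 f -> L2 g -> L2 (fun x => f x + g x).
Proof.
move=> Lf Lg; have m := cmeasD (L2_cmeas Lf) (L2_cmeas Lg).
case: (m) => mr mi; split => //.
apply: (@le_lt_trans _ _ (2%:E * N2 A f + 2%:E * N2 A g)%E); last first.
  by rewrite !sqnormE // -!EFinM -EFinD ltry.
apply: sqnorm_le => //; try exact: L2_cmeas.
by move=> x _; exact: sqnD_le2.
Qed.

Lemma sqnormD_le2 f g : cmeas A f -> cmeas A g ->
  (N2 A (fun x => (f x + g x)%R) <= 2%:E * N2 A f + 2%:E * N2 A g)%E.
Proof.
move=> mf mg; apply: sqnorm_le => //; first exact: cmeasD.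
by move=> x _; exact: sqnD_le2.
Qed.

Lemma sqnormM_le (b : K -> C) f (M : R) : cmeas A b -> cmeas A f -> 0 <= M ->
  (forall x, A x -> sqn (b x) <= M) ->
  (N2 A (fun x => (b x * f x)%R) <= M%:E * N2 A f)%E.
Proof.
move=> mb mf M0 bM; have := @sqnorm_le (fun x => b x * f x) M 0 f (fun=> 0).
rewrite mul0e adde0; apply => //; first exact: cmeasM.
by move=> x Ax; rewrite mul0r addr0 sqnM ler_wpM2r ?sqn_ge0 // bM.
Qed.

Lemma L2M b f (M : R) : cmeas A b ->
  (forall x, A x -> sqn (b x) <= M) -> L2 f -> L2 (fun x => b x * f x).
Proof.
move=> mb bM Lf; have m := cmeasM mb (L2_cmeas Lf).
case: (m) => mr mi; split => //.
apply: (@le_lt_trans _ _ ((`|M|)%:E * N2 A f)%E); last by rewrite sqnormE // -EFinM ltry.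
apply: sqnormM_le => //; first exact: L2_cmeas.
by move=> x Ax; apply: le_trans (bM x Ax) (ler_norm _).
Qed.

Lemma L2Z a f : L2 f -> L2 (fun x => a * f x).
Proof. by apply: (@L2M (fun=> a) f (sqn a)) => //; exact: cmeas_cst. Qed.

Lemma sqnormZ a f : cmeas A f -> N2 A (fun x => a * f x) = ((sqn a)%:E * N2 A f)%E.
Proof.
move=> mf; rewrite /sqnorm_on -ge0_integralZl //; first last.
- by rewrite lee_fin sqn_ge0.
- by move=> x _; rewrite lee_fin sqn_ge0.
- exact: cmeas_sqmod.
by apply: eq_integral => x _; rewrite -EFinM -sqnM.
Qed.

Lemma L2N f : L2 f -> L2 (fun x => - f x).
Proof. by move=> /(L2Z (-1)); under eq_fun do rewrite mulN1r. Qed.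

Lemma L2B f g : L2 f -> L2 g -> L2 (fun x => f x - g x).
Proof. by move=> Lf Lg; apply: (L2D Lf); exact: L2N. Qed.

Lemma L2J f : L2 f -> L2 (fun x => (f x)^*).
Proof.
move=> Lf; have [mr mi] := cmeasJ (L2_cmeas Lf); split => //.
suff -> : N2 A (fun x => (f x)^*) = N2 A f by case: Lf.
by apply: eq_integral => x _; rewrite /sqmod -!/(sqn _) sqnJ.
Qed.

Lemma L2_sum (I : Type) (s : seq I) (F : I -> K -> C) :
  (forall i, L2 (F i)) -> L2 (fun x => \sum_(i <- s) F i x).
Proof.
move=> LF; elim: s => [|i s IH].
  by under eq_fun do rewrite big_nil; exact: L20.
by under eq_fun do rewrite big_cons; exact: L2D.
Qed.

Lemma L2_integrable_sqn f : L2 f ->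
  mu.-integrable (A : set (borel K)) (EFin \o (fun x => sqn (f x))).
Proof.
move=> Lf; apply/integrableP; split.
  by apply/measurable_EFinP/cmeas_sqn/L2_cmeas.
under eq_integral do rewrite /= ger0_norm ?sqn_ge0 //.
by case: Lf.
Qed.

Lemma L2_prod_integrable f g : L2 f -> L2 g ->
  cintegrable A (fun x => f x * (g x)^*).
Proof.
move=> Lf Lg; apply: (@cintegrable_le _ _ _ _ _ mA _ (fun x => sqn (f x) + sqn (g x))).
- by apply: cmeasM; [exact: L2_cmeas|apply: cmeasJ; exact: L2_cmeas].
- rewrite (_ : _ \o _ = ((EFin \o (fun x => sqn (f x))) \+ (EFin \o (fun x => sqn (g x))))%E) //.
  by apply: integrableD => //; exact: L2_integrable_sqn.
- move=> x _; rewrite sqnM sqnJ.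
  have := sqn_ge0 (f x); have := sqn_ge0 (g x).
  by move: (sqn (f x)) (sqn (g x)) => a b; nra.
Qed.

Lemma innerJ f g : L2 f -> L2 g -> inner g f = (inner f g)^*.
Proof.
move=> Lf Lg; rewrite /inner -cintJ //; last exact: L2_prod_integrable.
by apply: eq_cint => x _; rewrite rmorphM /= conjCK mulrC.
Qed.

Lemma innerDl f g h : L2 f -> L2 g -> L2 h ->
  inner (fun x => f x + g x) h = inner f h + inner g h.
Proof.
move=> Lf Lg Lh; rewrite /inner -cintD //; try exact: L2_prod_integrable.
by apply: eq_cint => x _; rewrite mulrDl.
Qed.

Lemma innerZl a f h : L2 f -> L2 h -> inner (fun x => a * f x) h = a * inner f h.
Proof.
move=> Lf Lh; rewrite /inner -cintZ //; last exact: L2_prod_integrable.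
by apply: eq_cint => x _; rewrite mulrA.
Qed.

Lemma inner0l h : inner (fun=> 0) h = 0.
Proof.
rewrite /inner_on /cint; congr Complex; rewrite -(mul0r (fine (mu A))) -Rintegral_cst //;
by apply: eq_Rintegral => x _; rewrite mul0r.
Qed.

Lemma inner_suml (I : Type) (s : seq I) (F : I -> K -> C) h :
  (forall i, L2 (F i)) -> L2 h ->
  inner (fun x => \sum_(i <- s) F i x) h = \sum_(i <- s) inner (F i) h.
Proof.
move=> LF Lh; elim: s => [|i s IH].
  by under [X in inner X _]eq_fun do rewrite big_nil; rewrite big_nil inner0l.
under [X in inner X _]eq_fun do rewrite big_cons.
by rewrite innerDl // ?IH ?big_cons //; exact: L2_sum.
Qed.

Lemma innerDr f g h : L2 f -> L2 g -> L2 h ->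
  inner h (fun x => f x + g x) = inner h f + inner h g.
Proof.
move=> Lf Lg Lh; rewrite innerJ //; last exact: L2D.
by rewrite innerDl // rmorphD /= -!innerJ.
Qed.

Lemma innerZr a f h : L2 f -> L2 h -> inner h (fun x => a * f x) = a^* * inner h f.
Proof.
move=> Lf Lh; rewrite innerJ //; last exact: L2Z.
by rewrite innerZl // rmorphM /= -innerJ.
Qed.

Lemma inner_sumr (I : Type) (s : seq I) (F : I -> K -> C) h :
  (forall i, L2 (F i)) -> L2 h ->
  inner h (fun x => \sum_(i <- s) F i x) = \sum_(i <- s) inner h (F i).
Proof.
move=> LF Lh; rewrite innerJ //; last exact: L2_sum.
rewrite inner_suml // rmorph_sum; apply: eq_bigr => i _.
by rewrite /= -innerJ.
Qed.

Lemma innerBr f g h : L2 f -> L2 g -> L2 h ->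
  inner h (fun x => f x - g x) = inner h f - inner h g.
Proof.
move=> Lf Lg Lh; under [X in inner _ X]eq_fun do rewrite -mulN1r.
rewrite innerDr //; last exact: L2Z.
by rewrite innerZr // rmorphN1 mulN1r.
Qed.

Lemma innerBl f g h : L2 f -> L2 g -> L2 h ->
  inner (fun x => f x - g x) h = inner f h - inner g h.
Proof.
move=> Lf Lg Lh; under [X in inner X _]eq_fun do rewrite -mulN1r.
rewrite innerDl //; last exact: L2Z.
by rewrite innerZl // mulN1r.
Qed.

Lemma innerff f : L2 f -> inner f f = (nsq f)%:C%C.
Proof.
move=> Lf; apply: complexP => /=.
  rewrite /nsq /sqnorm_on /Rintegral; congr fine; apply: eq_integral => x _.
  by rewrite -sqnC.
rewrite -(mul0r (fine (mu A))) -Rintegral_cst //; apply: eq_Rintegral => x _.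
by rewrite -sqnC.
Qed.

Lemma nsqB f g : L2 f -> L2 g -> forall t : R,
  nsq (fun x => f x - t%:C%C * g x) =
  nsq f - t * (2 * complex.Re (inner f g)) + t ^+ 2 * nsq g.
Proof.
move=> Lf Lg t; have Lt : L2 (fun x => t%:C%C * g x) by exact: L2Z.
have Lb : L2 (fun x => f x - t%:C%C * g x) by exact: L2B.
suff : inner (fun x => f x - t%:C%C * g x) (fun x => f x - t%:C%C * g x) =
   (nsq f - t * (2 * complex.Re (inner f g)) + t ^+ 2 * nsq g)%:C%C.
  by rewrite innerff // => /complexI.
rewrite innerBr // !innerBl // !innerZl // !innerZr // !innerff //.
rewrite [inner g f]innerJ // conj_realC.
move: (inner f g) (nsq f) (nsq g) => [a b] x y.
by apply: complexP; rewrite ?(ReD, ImD, ReN, ImN, ReM, ImM) /=; ring.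
Qed.

(** The minimum over t is at t = 1/b when b > 0; when b = 0 the hypothesis is
    linear in t and forces c = 0. *)
Lemma real_quadratic (a b c : R) : 0 <= a -> 0 <= b ->
  (forall t, 0 <= a - 2 * t * c + t ^+ 2 * c * b) -> 0 <= c -> c <= a * b.
Proof.
move=> a0 b0 P c0; have [bE|bn] := eqVneq b 0.
  move: P; rewrite bE mulr0 => P; rewrite leNgt; apply/negP => cgt.
  have := P ((a + 1) / (2 * c)); rewrite mulr0 addr0.
  have -> : 2 * ((a + 1) / (2 * c)) * c = a + 1 by field; exact: lt0r_neq0.
  by lra.
have bp : 0 < b by rewrite lt0r bn.
have := P b^-1; rewrite -(pmulr_lge0 _ bp).
have -> : (a - 2 * b^-1 * c + b^-1 ^+ 2 * c * b) * b = a * b - c by field.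
by rewrite subr_ge0.
Qed.

(** Expand |f - t <f,g> g|^2 >= 0 for real t. *)
Lemma cauchy_schwarz f g : L2 f -> L2 g -> sqn (inner f g) <= nsq f * nsq g.
Proof.
move=> Lf Lg; apply: real_quadratic; rewrite ?nsq_ge0 ?sqn_ge0 // => t.
set z := inner f g.
have Lz : L2 (fun x => z * g x) by exact: L2Z.
have := nsq_ge0 A (fun x => f x - t%:C%C * (z * g x)).
rewrite nsqB // innerZr // -/z.
have -> : nsq (fun x => z * g x) = sqn z * nsq g.
  apply: complexI; rewrite -innerff // innerZl // innerZr // innerff //.
  by rewrite mulrA -sqnC rmorphM.
have -> : complex.Re (z^* * z) = sqn z by rewrite mulrC -sqnC.
by congr (_ <= _); ring.
Qed.

End Domain.
End L2Calculus.

(** * Orthonormal sequences *)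

Section OrthonormalSequences.
Context {R : realType} {K : topologicalFieldType}.
Variable mu : {measure set (borel K) -> \bar R}.
Local Notation C := R[i].
Variable A : set K.
Hypothesis mA : measurable (A : set (borel K)).
Local Notation L2 := (L2_on mu A).
Local Notation nsq := (nsq mu A).
Local Notation inner := (inner_on mu A).
Implicit Types (f g h : K -> C) (x : nat -> K -> C).

(** Finite linear combinations as lists of coefficient-index pairs: unlike
    [lin_span], where the coefficient is a function of the index, this form is
    closed under addition by concatenation. *)
Definition comb x g :=
  exists s : seq (C * nat), g = fun t => \sum_(z <- s) z.1 * x z.2 t.

Definition clspan x f :=
  L2 f /\ forall e : R, 0 < e -> exists2 g, comb x g & nsq (fun t => f t - g t) < e.

Lemma nsqD_le2 f g : L2 f -> L2 g ->
  nsq (fun t => f t + g t) <= 2 * nsq f + 2 * nsq g.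
Proof.
move=> Lf Lg; have := sqnormD_le2 mu mA (L2_cmeas Lf) (L2_cmeas Lg).
have Ls := L2D mA Lf Lg.
by rewrite (sqnormE Ls) (sqnormE Lf) (sqnormE Lg) -!EFinM -EFinD lee_fin.
Qed.

Lemma nsqZ a f : L2 f -> nsq (fun t => a * f t) = sqn a * nsq f.
Proof.
move=> Lf; apply: EFin_inj; rewrite -(sqnormE (L2Z mA a Lf)) (sqnormZ mu mA).
  by rewrite (sqnormE Lf) -EFinM.
exact: L2_cmeas Lf.
Qed.

Section Span.
Variable x : nat -> K -> C.
Hypothesis Lx : forall i, L2 (x i).

Lemma comb_L2 g : comb x g -> L2 g.
Proof. by case=> s ->; apply: L2_sum => // z; exact: L2Z. Qed.

Lemma combD f g : comb x f -> comb x g -> comb x (fun t => f t + g t).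
Proof.
case=> s -> [s' ->]; exists (s ++ s'); apply/funext => t.
by rewrite big_cat.
Qed.

Lemma combZ a f : comb x f -> comb x (fun t => a * f t).
Proof.
case=> s ->; exists [seq (a * z.1, z.2) | z <- s]; apply/funext => t.
rewrite big_map mulr_sumr; apply: eq_bigr => z _ /=.
by rewrite mulrA.
Qed.

Lemma comb1 i : comb x (x i).
Proof. by exists [:: (1, i)]; apply/funext => t; rewrite big_seq1 mul1r. Qed.

Lemma comb_clspan f : comb x f -> clspan x f.
Proof.
move=> cf; split=> [|e e0]; first exact: comb_L2.
exists f => //; rewrite /nsq.
under [X in sqnorm_on _ _ X]eq_fun do rewrite subrr.
by rewrite sqnorm0.
Qed.

Lemma clspan_lim f : L2 f ->
  (forall e : R, 0 < e -> exists2 g, clspan x g & nsq (fun t => f t - g t) < e) ->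
  clspan x f.
Proof.
move=> Lf fl; split => // e e0.
have [g [Lg gc] fg] := fl (e / 4) ltac:(by rewrite divr_gt0).
have [h ch gh] := gc (e / 4) ltac:(by rewrite divr_gt0).
exists h => //; have Lh := comb_L2 ch.
have := nsqD_le2 (L2B mA Lf Lg) (L2B mA Lg Lh).
have -> : (fun t => f t - g t + (g t - h t)) = (fun t => f t - h t).
  by apply/funext => t; rewrite addrA subrK.
by move=> /le_lt_trans; apply; lra.
Qed.

Lemma clspan0 : clspan x (fun=> 0).
Proof.
by apply: comb_clspan; exists [::]; apply/funext => t; rewrite big_nil.
Qed.

Lemma clspanD f g : clspan x f -> clspan x g -> clspan x (fun t => f t + g t).
Proof.
move=> [Lf cf] [Lg cg]; split=> [|e e0]; first exact: L2D.
have [f' cf' ff'] := cf (e / 4) ltac:(by rewrite divr_gt0).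
have [g' cg' gg'] := cg (e / 4) ltac:(by rewrite divr_gt0).
exists (fun t => f' t + g' t); first exact: combD.
have := nsqD_le2 (L2B mA Lf (comb_L2 cf')) (L2B mA Lg (comb_L2 cg')).
have -> : (fun t => f t - f' t + (g t - g' t)) = (fun t => f t + g t - (f' t + g' t)).
  by apply/funext => t; rewrite opprD addrACA.
by move=> /le_lt_trans; apply; lra.
Qed.

Lemma clspanZ a f : clspan x f -> clspan x (fun t => a * f t).
Proof.
move=> [Lf cf]; split=> [|e e0]; first exact: L2Z.
have a0 : 0 < sqn a + 1 by rewrite ltr_wpDl // sqn_ge0.
have [g cg fg] := cf (e / (sqn a + 1)) ltac:(by rewrite divr_gt0).
exists (fun t => a * g t); first exact: combZ.
have -> : (fun t => a * f t - a * g t) = (fun t => a * (f t - g t)).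
  by apply/funext => t; rewrite mulrBr.
rewrite nsqZ; last by apply: (L2B mA Lf); exact: comb_L2.
move: fg; rewrite ltr_pdivlMr // => /(le_lt_trans _); apply.
by rewrite mulrDr mulr1 mulrC lerDl nsq_ge0.
Qed.

Lemma clspan_sum (I : Type) (s : seq I) (G : I -> K -> C) :
  (forall i, clspan x (G i)) -> clspan x (fun t => \sum_(i <- s) G i t).
Proof.
move=> cG; elim: s => [|i s IH].
  by under eq_fun do rewrite big_nil; exact: clspan0.
by under eq_fun do rewrite big_cons; exact: clspanD.
Qed.

Hypothesis xon : forall i j, inner (x i) (x j) = (i == j)%:R.

Definition fourier_sum n f : K -> C := fun t => \sum_(k < n) inner f (x k) * x k t.

Lemma fourier_sum_L2 n f : L2 (fourier_sum n f).
Proof. by apply: L2_sum => // i; exact: L2Z. Qed.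

Lemma fourier_sum_id n i : (i < n)%N -> fourier_sum n (x i) = x i.
Proof.
move=> ni; apply/funext => t; rewrite /fourier_sum (bigD1 (Ordinal ni)) //=.
rewrite xon eqxx mul1r big1 ?addr0 // => k ki.
rewrite xon (_ : (i == k) = false) ?mul0r //.
by apply: contraNF ki => /eqP e; apply/eqP/val_inj.
Qed.

Lemma inner_fourier_sum n f i : (i < n)%N -> inner (fourier_sum n f) (x i) = inner f (x i).
Proof.
move=> ni; rewrite inner_suml //; last by move=> k; exact: L2Z.
rewrite (bigD1 (Ordinal ni)) //= innerZl // xon eqxx mulr1 big1 ?addr0 // => k ki.
rewrite innerZl // xon (_ : (val k == i) = false) ?mulr0 //.
by apply: contraNF ki => /eqP e; apply/eqP/val_inj.
Qed.

Lemma nsq_fourier_residual n f : L2 f ->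
  nsq (fun t => f t - fourier_sum n f t) = nsq f - \sum_(k < n) sqn (inner f (x k)).
Proof.
move=> Lf; have Ls := fourier_sum_L2 n f.
have ifs g : L2 g -> inner g (fourier_sum n f) = \sum_(k < n) (inner f (x k))^* * inner g (x k).
  move=> Lg; rewrite inner_sumr //; last by move=> k; exact: L2Z.
  by apply: eq_bigr => k _; rewrite innerZr.
have E1 : inner f (fourier_sum n f) = (\sum_(k < n) sqn (inner f (x k)))%:C%C.
  by rewrite ifs // sum_sqnC; apply: eq_bigr => k _; rewrite mulrC.
have E2 : inner (fourier_sum n f) (fourier_sum n f) =
    (\sum_(k < n) sqn (inner f (x k)))%:C%C.
  rewrite ifs // sum_sqnC; apply: eq_bigr => k _.
  by rewrite inner_fourier_sum // mulrC.
have Lb : L2 (fun t => f t - fourier_sum n f t) by exact: L2B.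
apply: complexI; rewrite -innerff // innerBr // !innerBl //.
rewrite E1 E2 [inner (fourier_sum n f) f]innerJ // E1 conj_realC innerff // subrr subr0.
by rewrite -rmorphB.
Qed.

Lemma bessel n f : L2 f -> \sum_(k < n) sqn (inner f (x k)) <= nsq f.
Proof. by move=> Lf; rewrite -subr_ge0 -nsq_fourier_residual // nsq_ge0. Qed.

Lemma comb_fourier_sum g : comb x g -> exists n, fourier_sum n g = g.
Proof.
case=> s gE; exists (\max_(z <- s) z.2).+1.
rewrite /fourier_sum; apply/funext => t.
have innE k : inner g (x k) = \sum_(z <- s) z.1 * inner (x z.2) (x k).
  rewrite gE; apply: etrans (@inner_suml _ _ mu A mA _ s (fun z t => z.1 * x z.2 t) _ _ _) _ => //.
    by move=> z; exact: L2Z.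
  by apply: eq_bigr => z _; rewrite innerZl.
transitivity (\sum_(k < (\max_(z <- s) z.2).+1)
    \sum_(z <- s) z.1 * inner (x z.2) (x k) * x k t).
  by apply: eq_bigr => k _; rewrite innE mulr_suml.
rewrite [in RHS]gE.
rewrite exchange_big /= big_seq [RHS]big_seq; apply: eq_bigr => z zs.
have zn : (z.2 < (\max_(z <- s) z.2).+1)%N.
  by rewrite ltnS; exact: leq_bigmax_seq.
under eq_bigr => k _ do rewrite -mulrA.
by rewrite -mulr_sumr; congr (_ * _); have /(congr1 (@^~ t)) := fourier_sum_id zn.
Qed.

(** The projection onto the first n vectors fixes g, so the residual of f is
    that of f - g. *)
Lemma nsq_fourier_residual_le n f g : L2 f -> L2 g -> fourier_sum n g = g ->
  nsq (fun t => f t - fourier_sum n f t) <= nsq (fun t => f t - g t).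
Proof.
move=> Lf Lg gE; have Lfg := L2B mA Lf Lg.
have -> : (fun t => f t - fourier_sum n f t) =
    (fun t => (f t - g t) - fourier_sum n (fun t => f t - g t) t).
  apply/funext => t.
  have -> : fourier_sum n (fun t => f t - g t) t = fourier_sum n f t - fourier_sum n g t.
    rewrite /fourier_sum -sumrB; apply: eq_bigr => k _.
    by rewrite innerBl // mulrBl.
  by rewrite gE opprB addrA subrK.
by rewrite nsq_fourier_residual // gerBl sumr_ge0 // => k _; exact: sqn_ge0.
Qed.

(** The residual after n terms is at most the distance of f to any combination
    of the first n vectors, and f is a limit of such combinations. *)
Lemma parseval f : clspan x f ->
  (\sum_(0 <= k <oo) sqmod (inner f (x k)) = sqnorm_on mu A f)%E.
Proof.
move=> [Lf cf].
have sumE n : (\sum_(0 <= k < n) sqmod (inner f (x k)))%E =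
    (\sum_(k < n) sqn (inner f (x k)))%:E.
  by rewrite big_mkord sumEFin.
have ge0 k : (0 <= sqmod (inner f (x k)))%E by rewrite lee_fin sqn_ge0.
apply/eqP; rewrite eq_le; apply/andP; split.
  apply: lime_le; first exact: is_cvg_nneseries.
  by apply: nearW => n; rewrite sumE (sqnormE Lf) lee_fin; exact: bessel.
apply/lee_addgt0Pr => e e0.
have [g cg fg] := cf e e0; have [n gE] := comb_fourier_sum cg.
have := nsq_fourier_residual_le Lf (comb_L2 cg) gE.
rewrite nsq_fourier_residual // => /le_lt_trans /(_ fg); rewrite ltrBlDr => lt.
rewrite (sqnormE Lf); apply: (@le_trans _ _ (e + \sum_(k < n) sqn (inner f (x k)))%:E).
  by rewrite lee_fin ltW.
rewrite EFinD addeC leeD2r // -sumE.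
by apply: nneseries_lim_ge => k _ _; exact: ge0.
Qed.

End Span.
End OrthonormalSequences.

(** * L2-convergent series *)

Section L2Series.
Context {R : realType} {K : topologicalFieldType}.
Variable mu : {measure set (borel K) -> \bar R}.
Local Notation C := R[i].
Variable A : set K.
Hypothesis mA : measurable (A : set (borel K)).

Lemma L2_series_tail (t : nat -> K -> C) f : L2_series_on mu A t f ->
  (forall k, L2_on mu A (t k)) -> forall e : R, 0 < e -> exists N, forall n,
  (N <= n)%N -> nsq mu A (fun x => f x - \sum_(k < n) t k x) < e.
Proof.
move=> [Lf cvf] Lt e e0.
have e0' : (0 < e%:E)%E by rewrite lte_fin.
have [N _ NP] := cvf _ (open_ereal_lt' e0'); exists N => n Nn.
have := NP n Nn; rewrite /= sqnormE ?lte_fin //.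
by apply: L2B => //; exact: L2_sum.
Qed.

(** Cauchy-Schwarz for the difference f - g. *)
Lemma inner_le_approx f g h (e : R) : L2_on mu A f -> L2_on mu A g -> L2_on mu A h ->
  nsq mu A (fun x => f x - g x) <= e ->
  sqn (inner_on mu A f h - inner_on mu A g h) <= e * nsq mu A h.
Proof.
move=> Lf Lg Lh fge; rewrite -innerBl //.
apply: le_trans (cauchy_schwarz mA (L2B mA Lf Lg) Lh) _.
by rewrite ler_wpM2r // nsq_ge0.
Qed.

End L2Series.

(** * Change of variables *)

Section ChangeOfVariables.
Context {R : realType} {K : topologicalFieldType}.
Variable mu : {measure set (borel K) -> \bar R}.
Local Notation C := R[i].
Implicit Types (f g : K -> C) (A : set K).

Section Scaled.
Variables (tau : K -> K) (k : {nonneg R}).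
Hypotheses (tau_cont : continuous tau)
  (tau_mu : forall E : set K, measurable (E : set (borel K)) ->
     mu (tau @^-1` E) = ((k%:num)%:E * mu E)%E).

Let mtau : measurable_fun [set: borel K] (tau : borel K -> borel K).
Proof. exact: continuous_borel. Qed.

(** A map that scales masses by k pushes mu forward to k mu. *)
Lemma ge0_integral_comp A (F : K -> \bar R) :
  measurable (A : set (borel K)) ->
  measurable_fun (A : set (borel K)) (F : borel K -> \bar R) ->
  (forall x, A x -> (0 <= F x)%E) ->
  (\int[mu]_(x in (tau @^-1` A : set (borel K))) F (tau x) =
   (k%:num)%:E * \int[mu]_(x in (A : set (borel K))) F x)%E.
Proof.
move=> mA mF F0; rewrite -ge0_integral_mscale //.
have := ge0_integral_pushforward mtau mu mA mF.
rewrite /comp => <-; last by move=> x; rewrite inE; exact: F0.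
by apply: eq_measure_integral => E mE _; exact: tau_mu.
Qed.

Lemma measurable_fun_comp_cont {d} {T : sigmaRingType d} A (F : borel K -> T) :
  measurable (A : set (borel K)) ->
  measurable_fun (A : set (borel K)) F ->
  measurable_fun (tau @^-1` A : set (borel K)) (fun x => F (tau x)).
Proof.
move=> mA mF; apply: (measurable_comp mA _ mF); last exact: measurable_funTS.
by move=> _ [x Ax <-].
Qed.

Lemma sqnorm_comp A f : measurable (A : set (borel K)) -> L2_on mu A f ->
  sqnorm_on mu (tau @^-1` A) (fun x => f (tau x)) =
  ((k%:num)%:E * sqnorm_on mu A f)%E.
Proof.
move=> mA Lf; apply: (@ge0_integral_comp A (fun x => sqmod (f x)) mA).
  exact: cmeas_sqmod (L2_cmeas Lf).
by move=> x _; rewrite lee_fin; exact: sqn_ge0.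
Qed.

Lemma L2_comp A f : measurable (A : set (borel K)) -> L2_on mu A f ->
  L2_on mu (tau @^-1` A) (fun x => f (tau x)).
Proof.
move=> mA Lf; have [mr mi] := L2_cmeas Lf; split.
- exact: measurable_fun_comp_cont mA mr.
- exact: measurable_fun_comp_cont mA mi.
- by rewrite sqnorm_comp // (sqnormE Lf) -EFinM ltry.
Qed.

Hypothesis k1 : k%:num = 1.

(** The positive and the negative parts are transported separately. *)
Lemma cint_comp A f : measurable (A : set (borel K)) -> cmeas (A : set (borel K)) f ->
  @cint _ (borel K) R mu (tau @^-1` A) (fun x => f (tau x)) =
  @cint _ (borel K) R mu A f.
Proof.
move=> mA [mr mi].
have e (F : K -> R) : measurable_fun (A : set (borel K)) (F : borel K -> R) ->
  \int[mu]_(x in (tau @^-1` A : set (borel K))) F (tau x) =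
  \int[mu]_(x in (A : set (borel K))) F x.
  move=> /measurable_EFinP mF; rewrite /Rintegral; congr fine.
  rewrite integralE [RHS]integralE.
  have := @ge0_integral_comp A ((EFin \o F)^\+)%E mA.
  rewrite k1 mul1e => <-; first last.
  - by move=> x _; exact: funepos_ge0.
  - exact: measurable_funepos.
  have := @ge0_integral_comp A ((EFin \o F)^\-)%E mA.
  rewrite k1 mul1e => <-; first last.
  - by move=> x _; exact: funeneg_ge0.
  - exact: measurable_funeneg.
  by congr (_ - _)%E; apply: eq_integral => x _; rewrite ?funeposE ?funenegE.
by congr Complex; exact: e.
Qed.

End Scaled.

Section Translation.
Hypothesis muH : haar_measure mu.
Variable a : K.

Let tau (x : K) := x + a.

Let tauE : tau = (fun x => a + x).
Proof. by apply/funext => x; rewrite /tau addrC. Qed.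

Let tau_cont : continuous tau. Proof. by rewrite tauE; exact: addl_continuous. Qed.

Let tau_mu (E : set K) : measurable (E : set (borel K)) ->
  mu (tau @^-1` E) = ((1%:nng : {nonneg R})%:num%:E * mu E)%E.
Proof.
move=> mE; rewrite mul1e -(haar_translation muH (- a) mE) image_addlE opprK.
by rewrite tauE.
Qed.

Section Domain.
Variable A : set K.
Hypotheses (mA : measurable (A : set (borel K))) (Aa : forall x, A (x + a) <-> A x).

Let preA : tau @^-1` A = A.
Proof. by apply/seteqP; split => x /Aa. Qed.

Lemma L2_shift f : L2_on mu A f -> L2_on mu A (fun x => f (x + a)).
Proof. by move=> Lf; have := L2_comp tau_cont tau_mu mA Lf; rewrite preA. Qed.

Lemma sqnorm_shift f : L2_on mu A f ->
  sqnorm_on mu A (fun x => f (x + a)) = sqnorm_on mu A f.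
Proof.
by move=> Lf; have := sqnorm_comp tau_cont tau_mu mA Lf; rewrite preA mul1e.
Qed.

Lemma cint_shift f : cmeas (A : set (borel K)) f ->
  @cint _ (borel K) R mu A (fun x => f (x + a)) = @cint _ (borel K) R mu A f.
Proof.
by move=> mf; have := cint_comp tau_cont tau_mu erefl mA mf; rewrite preA.
Qed.

Lemma inner_shift f g : L2_on mu A f -> L2_on mu A g ->
  inner_on mu A (fun x => f (x + a)) (fun x => g (x + a)) = inner_on mu A f g.
Proof.
move=> Lf Lg; apply: (cint_shift (f := fun x => f x * (g x)^*)).
by apply: cmeasM; [exact: L2_cmeas Lf|apply: cmeasJ; exact: L2_cmeas Lg].
Qed.

End Domain.
End Translation.

Section Dilation.
Variable abs : K -> R.
Hypotheses (absH : haar_modulus mu abs) (abs_ge0 : forall x, 0 <= abs x).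
Variable b : K.
Hypothesis b0 : b != 0.

Let tau_mu (E : set K) : measurable (E : set (borel K)) ->
  mu ((fun x => b * x) @^-1` E) = ((NngNum (abs_ge0 b^-1))%:num%:E * mu E)%E.
Proof.
have bV0 : b^-1 != 0 by rewrite invr_eq0.
move=> mE; case: absH => _ /(_ _ E bV0 mE) <-.
by rewrite image_mullE // invrK.
Qed.

Lemma L2_dilate f : L2 mu f -> L2 mu (fun x => f (b * x)).
Proof.
by move=> Lf; have := L2_comp (@mull_continuous K b) tau_mu measurableT Lf.
Qed.

Lemma sqnorm_dilate f : L2 mu f ->
  sqnorm_on mu [set: K] (fun x => f (b * x)) =
  ((abs b^-1)%:E * sqnorm_on mu [set: K] f)%E.
Proof.
by move=> Lf; have := sqnorm_comp (@mull_continuous K b) tau_mu measurableT Lf.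
Qed.

End Dilation.
End ChangeOfVariables.

(** * The lattice of the u(n) as a polynomial ring *)

Section DigitExpansion.
Implicit Types (b n m k t : nat).

Definition digit b n k := ((n %/ b ^ k) %% b)%N.

Lemma digit0n b k : digit b 0 k = 0%N.
Proof. by rewrite /digit div0n mod0n. Qed.

Lemma digit_inj b n m : (1 < b)%N ->
  (forall k, digit b n k = digit b m k) -> n = m.
Proof.
move=> b1; have [t nt] := ubnP n; elim: t n m nt => // t IH n m nt nm.
have [n0|n0] := posnP n.
  have [->//|m0] := posnP m.
  have [k kP] : exists k, digit b m k != 0%N.
    exists (trunc_log b m); rewrite /digit.
    have /andP[l1 l2] := trunc_log_bounds b1 m0.
    rewrite modn_small; first by rewrite -lt0n divn_gt0 ?expn_gt0 ?(ltnW b1).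
    by rewrite ltn_divLR ?expn_gt0 ?(ltnW b1) // -expnS.
  by case/eqP: kP; rewrite -nm n0 digit0n.
have e0 := nm 0%N; rewrite /digit !expn0 !divn1 in e0.
rewrite (divn_eq n b) (divn_eq m b) e0; congr (_ * _ + _)%N; apply: IH.
  by rewrite ltnS in nt; exact: leq_trans (ltn_Pdiv b1 n0) nt.
by move=> k; have := nm k.+1; rewrite /digit !expnS !divnMA.
Qed.

Lemma digit_small b n k t : (n < b ^ t)%N -> (t <= k)%N -> digit b n k = 0%N.
Proof.
case: b => [|[|b]] nt tk; rewrite /digit ?modn1 //.
  case: t nt tk => [|t]; last by rewrite exp0n.
  by rewrite expn0 ltnS leqn0 => /eqP -> _; rewrite div0n.
by rewrite divn_small // (leq_trans nt) // leq_exp2l.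
Qed.

Definition undigits b (s : seq nat) := foldr (fun d n => d + b * n)%N 0%N s.

Lemma digit_undigits b s k : all (fun d => d < b)%N s ->
  digit b (undigits b s) k = nth 0%N s k.
Proof.
elim: s k => [|d s IH] k /=; first by rewrite digit0n nth_nil.
case/andP => db sb; case: k => [|k]; rewrite /digit /=.
  by rewrite expn0 divn1 mulnC addnC modnMDl modn_small.
have b0 : (0 < b)%N by exact: leq_ltn_trans db.
rewrite expnS divnMA.
have -> : ((d + b * undigits b s) %/ b = undigits b s)%N.
  by rewrite mulnC addnC divnMDl // divn_small // addn0.
exact: IH.
Qed.

Lemma undigits_lt b s : all (fun d => d < b)%N s ->
  (undigits b s < b ^ size s)%N.
Proof.
elim: s => [//|d s IH] /= /andP[db /IH lt]; rewrite expnS.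
apply: leq_trans (_ : b * (undigits b s).+1 <= _)%N; last by rewrite leq_mul2l lt orbT.
by rewrite mulnS ltn_add2r.
Qed.

End DigitExpansion.

Section Lattice.
Context {K : fieldType}.
Variables (p c : nat) (eps : 'I_c -> K) (varpi : K).
Variables (F : finFieldType) (f : {rmorphism F -> K}).
Hypotheses (pK : p \in [pchar K]) (cardF : #|F| = (p ^ c)%N)
  (rangef : range f = prime_span eps) (varpi0 : varpi != 0).

Local Notation q := (p ^ c)%N.
Local Notation u := (u p eps varpi).

Let p1 : (1 < p)%N. Proof. by rewrite prime_gt1 // (pcharf_prime pK). Qed.

Let q1 : (1 < q)%N. Proof. by rewrite -cardF card_finNzRing_gt1. Qed.

Lemma span_size_gt0 : (0 < c)%N.
Proof. by rewrite lt0n; apply: contraTneq q1 => ->. Qed.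

Let natr_modp n : (n %% p)%:R = n%:R :> K.
Proof.
rewrite [in RHS](divn_eq n p) natrD natrM.
by have /andP[_ /eqP ->] := pK; rewrite mulr0 add0r.
Qed.

Lemma residue_ex n : exists z, f z = \sum_(k < c) (digit p n k)%:R * eps k.
Proof.
have : prime_span eps (\sum_(k < c) (digit p n k)%:R * eps k).
  by exists (fun k => digit p n k).
by rewrite -rangef => -[z _ zE]; exists z.
Qed.

(** The element of GF(q) whose image in K has the base-p digits of n as
    coordinates on the basis eps. *)
Definition residue n : F := projT1 (cid (residue_ex n)).

Lemma residueE n : f (residue n) = \sum_(k < c) (digit p n k)%:R * eps k.
Proof. exact: (projT2 (cid (residue_ex n))). Qed.

(** Coordinates in GF(p) may be reduced modulo p, and then are the digits of a
    number below q. *)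
Lemma residue_surj z : exists2 n, (n < q)%N & residue n = z.
Proof.
have : prime_span eps (f z) by rewrite -rangef; exists z.
case=> a _ aE; pose s := [seq (a k %% p)%N | k <- enum 'I_c].
have sz : size s = c by rewrite size_map size_enum_ord.
have sp : all (fun d => d < p)%N s.
  by apply/allP => _ /mapP[k _ ->]; rewrite ltn_mod ltnW.
exists (undigits p s); first by rewrite -[X in (_ < _ ^ X)%N]sz undigits_lt.
apply: (fmorph_inj f); rewrite residueE -aE; apply: eq_bigr => k _.
rewrite digit_undigits // (nth_map k) ?size_enum_ord // nth_ord_enum.
by rewrite natr_modp.
Qed.

(** A surjection between finite sets of the same size q. *)
Lemma residue_bij : bijective (fun n : 'I_q => residue n).
Proof.
have [g gK] : exists g : F -> 'I_q, cancel g (fun n : 'I_q => residue n).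
  have : forall z, exists n : 'I_q, residue n = z.
    by move=> z; have [n nq nz] := residue_surj z; exists (Ordinal nq).
  by move=> /choice [g gP]; exists g.
have cE : #|F| = #|'I_q| by rewrite card_ord.
have [h hK Kh] := inj_card_bij (can_inj gK) ltac:(by rewrite cE).
exists g => // n; rewrite -[n]Kh.
by rewrite gK.
Qed.

Lemma residue0 : residue 0 = 0.
Proof.
apply: (fmorph_inj f); rewrite residueE rmorph0 big1 // => k _.
by rewrite digit0n mul0r.
Qed.

Lemma residue_inj n m : (n < q)%N -> (m < q)%N -> residue n = residue m -> n = m.
Proof.
move=> nq mq e.
by have [] := bij_inj residue_bij (e : residue (Ordinal nq) = residue (Ordinal mq)).
Qed.

Definition residue_inv z : nat := projT1 (cid2 (residue_surj z)).

Lemma residue_inv_lt z : (residue_inv z < q)%N.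
Proof. by rewrite /residue_inv; case: cid2. Qed.

Lemma residue_invK z : residue (residue_inv z) = z.
Proof. by rewrite /residue_inv; case: cid2. Qed.

Lemma residueK n : (n < q)%N -> residue_inv (residue n) = n.
Proof.
by move=> nq; apply: residue_inj (residue_invK _) => //; exact: residue_inv_lt.
Qed.

(** Turns the base-q expansion of n into a polynomial over GF(q), so that
    addition of the u(n) becomes addition of polynomials. *)
Definition lat_poly n : {poly F} := \poly_(k < n.+1) residue (digit q n k).

(** The inverse of [lat_poly]. *)
Definition lat_index (P : {poly F}) : nat := undigits q [seq residue_inv z | z <- P].

(** The lattice point of a polynomial: varpi^-1 P(varpi^-1), so that u(n) is
    the point of [lat_poly n]. *)
Definition lat_ev (P : {poly F}) : K := varpi^-1 * (map_poly f P).[varpi^-1].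

Lemma coef_lat_poly n k : (lat_poly n)`_k = residue (digit q n k).
Proof.
rewrite coef_poly; case: ltnP => // nk; rewrite (@digit_small _ _ _ n.+1) ?residue0 //.
exact: leq_trans (ltn_expl _ q1) (leq_pexp2l (ltnW q1) (leqnSn n)).
Qed.

Let all_inv (s : seq F) : all (fun d => d < q)%N [seq residue_inv z | z <- s].
Proof. by apply/allP => _ /mapP[z _ ->]; exact: residue_inv_lt. Qed.

Lemma digit_lat_index P k : digit q (lat_index P) k = residue_inv P`_k.
Proof.
rewrite digit_undigits //; case: (ltnP k (size P)) => kP; first exact: nth_map.
by rewrite !nth_default ?size_map // -residue0 residueK // ltnW.
Qed.

Lemma lat_indexK : cancel lat_index lat_poly.
Proof.
by move=> P; apply/polyP => k; rewrite coef_lat_poly digit_lat_index residue_invK.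
Qed.

Lemma lat_polyK : cancel lat_poly lat_index.
Proof.
move=> n; apply: (digit_inj q1) => k.
by rewrite digit_lat_index coef_lat_poly residueK // ltn_mod ltnW.
Qed.

(** The numbers below q^t are exactly the polynomials of size at most t, a
    group under addition. *)
Lemma size_lat_poly n t : (size (lat_poly n) <= t)%N = (n < q ^ t)%N.
Proof.
apply/idP/idP => [st|nt].
  rewrite -[n]lat_polyK; apply: leq_trans (undigits_lt (all_inv _)) _.
  by rewrite size_map leq_exp2l.
by apply/leq_sizeP => k tk; rewrite coef_lat_poly (digit_small nt) ?residue0.
Qed.

Lemma lat_polyMX k : lat_poly (q * k) = 'X * lat_poly k.
Proof.
apply/polyP => i; rewrite coefXM coef_lat_poly; case: i => [|i] /=.
  by rewrite /digit expn0 divn1 modnMr residue0.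
by rewrite coef_lat_poly /digit expnS divnMA mulKn // ltnW.
Qed.

Lemma lat_poly_coef0 n : (lat_poly n)`_0 = 0 -> exists k, n = (q * k)%N.
Proof.
rewrite coef_lat_poly -residue0 => e; exists (n %/ q)%N.
have : digit q n 0 = 0%N by apply: residue_inj e; rewrite // ?ltn_mod ltnW.
by rewrite /digit expn0 divn1 => n0; rewrite {1}(divn_eq n q) n0 addn0 mulnC.
Qed.

Lemma lat_evD P Q : lat_ev (P + Q) = lat_ev P + lat_ev Q.
Proof. by rewrite /lat_ev rmorphD hornerD mulrDr. Qed.

Lemma lat_evB P Q : lat_ev (P - Q) = lat_ev P - lat_ev Q.
Proof. by rewrite /lat_ev rmorphB hornerD hornerN mulrBr. Qed.

Lemma lat_evMX P : lat_ev ('X * P) = varpi^-1 * lat_ev P.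
Proof. by rewrite /lat_ev rmorphM /= map_polyX hornerM hornerX. Qed.

Lemma lat_ev_sum (P : {poly F}) n : (size P <= n)%N ->
  lat_ev P = \sum_(i < n) f P`_i * varpi ^ (- i.+1%:Z).
Proof.
move=> sP; have sfP : (size (map_poly f P) <= n)%N by rewrite size_map_poly.
rewrite /lat_ev (horner_coef_wide _ sfP).
rewrite mulr_sumr; apply: eq_bigr => i _.
by rewrite coef_map /= mulrCA -exprnN -exprVn exprS.
Qed.

Lemma lat_evE n : lat_ev (lat_poly n) = u n.
Proof.
rewrite (@lat_ev_sum _ n.+1) ?size_poly //; apply: eq_bigr => i _.
rewrite coef_lat_poly residueE /u_digit -mulrA -/(digit q n i); congr (_ * _).
by rewrite -exprnN -!exprVn exprS.
Qed.

Lemma u_lt n : (n < q)%N -> u n = varpi^-1 * f (residue n).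
Proof.
move=> nq; rewrite -lat_evE (_ : lat_poly n = (residue n)%:P).
  by rewrite /lat_ev map_polyC /= hornerC.
apply/polyP => -[|i]; rewrite coefC coef_lat_poly /=.
  by rewrite /digit expn0 divn1 modn_small.
by rewrite (@digit_small _ _ _ 1) ?residue0.
Qed.

(** The index of u(qk) + u(m), and in [lat_unshift] that of u(m) - u(qk). *)
Definition lat_shift k m := lat_index ('X * lat_poly k + lat_poly m).
Definition lat_unshift k m := lat_index (lat_poly m - 'X * lat_poly k).

Lemma lat_shiftK k : cancel (lat_shift k) (lat_unshift k).
Proof. by move=> m; rewrite /lat_unshift lat_indexK addrC addKr lat_polyK. Qed.

Lemma lat_unshiftK k : cancel (lat_unshift k) (lat_shift k).
Proof. by move=> m; rewrite /lat_shift lat_indexK addrC subrK lat_polyK. Qed.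

Lemma u_shift k m : u (lat_shift k m) = varpi^-1 * u k + u m.
Proof. by rewrite -!lat_evE lat_indexK lat_evD lat_evMX. Qed.

Lemma u_unshift k m : u (lat_unshift k m) = u m - u (q * k).
Proof. by rewrite -!lat_evE lat_indexK lat_evB lat_polyMX. Qed.

(** Polynomials of size at most t are closed under adding and subtracting one
    of them. *)
Lemma lat_shift_lt k m t : (q * k < q ^ t)%N ->
  (lat_shift k m < q ^ t)%N = (m < q ^ t)%N.
Proof.
have sh a b : (q * a < q ^ t)%N -> (b < q ^ t)%N -> (lat_shift a b < q ^ t)%N /\
    (lat_unshift a b < q ^ t)%N.
  rewrite -!size_lat_poly !lat_indexK lat_polyMX => sa sb; split.
    by apply: leq_trans (size_polyD _ _) _; rewrite geq_max sa.
  by apply: leq_trans (size_polyD _ _) _; rewrite geq_max sb size_polyN.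
move=> kt; apply/idP/idP => mt; last by have [] := sh k m kt mt.
by have [_] := sh k _ kt mt; rewrite lat_shiftK.
Qed.

End Lattice.

(** * The basic character on the lattice *)

Section Characters.
Context {R : realType} {K : topologicalFieldType}.
Local Notation C := R[i].
Variables (p c : nat) (eps : 'I_c -> K) (varpi : K).
Variables (F : finFieldType) (f : {rmorphism F -> K}).
Hypotheses (pK : p \in [pchar K]) (cardF : #|F| = (p ^ c)%N)
  (rangef : range f = prime_span eps) (varpi0 : varpi != 0)
  (eps0 : forall i : 'I_c, i = 0%N :> nat -> eps i = 1).
Variable chi : K -> C.
Hypothesis chi_basic : basic_character p eps varpi chi.

Local Notation q := (p ^ c)%N.
Local Notation u := (u p eps varpi).
Local Notation lat_ev := (lat_ev varpi f).
Local Notation lat_poly := (lat_poly p rangef).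
Local Notation residue := (residue p rangef).

Lemma chiD x y : chi (x + y) = chi x * chi y.
Proof. by case: chi_basic. Qed.

Lemma chi_norm x : `|chi x| = 1.
Proof. by case: chi_basic. Qed.

Lemma chi_neq0 x : chi x != 0.
Proof. by rewrite -normr_eq0 chi_norm oner_eq0. Qed.

Lemma chi0 : chi 0 = 1.
Proof. by apply: (mulfI (chi_neq0 0)); rewrite -chiD addr0 mulr1. Qed.

Lemma chiN x : chi (- x) = (chi x)^*.
Proof.
apply: (mulfI (chi_neq0 x)); rewrite -chiD subrr chi0.
by have := sqr_normc (chi x); rewrite chi_norm expr1n.
Qed.

Lemma sqn_chi x : sqn (chi x) = 1.
Proof. by rewrite sqn_norm1 // chi_norm. Qed.

Lemma chi_sum (I : Type) (s : seq I) (G : I -> K) :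
  chi (\sum_(i <- s) G i) = \prod_(i <- s) chi (G i).
Proof. exact: (big_morph chi chiD chi0). Qed.

Lemma chi_natM n x : chi (n%:R * x) = chi x ^+ n.
Proof.
elim: n => [|n IH]; first by rewrite mul0r chi0.
by rewrite -natr1 mulrDl mul1r chiD IH exprSr.
Qed.

(** GF(q) is spanned by the eps over GF(p), and chi is trivial on all the
    products eps_i varpi^(-j) with j <> 1. *)
Lemma chi_residue_pow z (j : int) : j != 1 -> chi (f z * varpi ^ (- j)) = 1.
Proof.
move=> j1; have : prime_span eps (f z) by rewrite -rangef; exists z.
case=> a _ <-; rewrite mulr_suml chi_sum big1 // => i _.
rewrite -mulrA chi_natM; case: chi_basic => _ _ _ ->.
by rewrite (negbTE j1) andbF expr1n.
Qed.

Lemma cos_lt1 (x : R) : 0 < x <= pi -> cos x < 1.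
Proof.
case/andP => x0 xpi; rewrite -cos0 ltr_cos // in_itv /= ?lexx ?pi_ge0 //.
by rewrite xpi ltW.
Qed.

(** The value is exp(2 pi i / p), whose real part is less than 1 because 0 < 2
    pi / p <= pi. *)
Lemma chi_varpiV : chi varpi^-1 != 1.
Proof.
have c0 := span_size_gt0 cardF.
have p2 : (2 <= p)%N by rewrite prime_gt1 // (pcharf_prime pK).
have -> : varpi^-1 = eps (Ordinal c0) * varpi ^ (- 1%:Z).
  by rewrite eps0 // mul1r -exprnN expr1.
case: chi_basic => _ _ _ -> /=; apply/eqP => /(congr1 (@complex.Re R)) /= e.
have p0 : 0 < p%:R :> R by rewrite ltr0n (leq_trans _ p2).
suff : cos (2 * pi / p%:R) < 1 :> R by rewrite e ltxx.
apply: cos_lt1; apply/andP; split.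
  by rewrite divr_gt0 // mulr_gt0 // pi_gt0.
by rewrite ler_pdivrMr // mulrC ler_wpM2l ?pi_ge0 // ler_nat.
Qed.

(** Only the term in varpi^-1 of the product contributes. *)
Lemma chi_lat_ev (P : {poly F}) z d :
  chi (lat_ev P * (f z * varpi ^+ d)) = chi (f (P`_d * z) * varpi^-1).
Proof.
pose n := maxn (size P) d.+1; have dn : (d < n)%N by rewrite leq_maxr.
rewrite (@lat_ev_sum _ _ _ _ _ n) ?leq_maxl // mulr_suml chi_sum.
have termE i : f P`_i * varpi ^ (- i.+1%:Z) * (f z * varpi ^+ d) =
    f (P`_i * z) * varpi ^ (- (i.+1%:Z - d%:Z)).
  rewrite rmorphM /= mulrACA; congr (_ * _).
  by rewrite opprB addrC expfzDr.
rewrite (bigD1 (Ordinal dn)) //= big1 ?mulr1 => [|i id].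
  rewrite termE; congr (chi (_ * _)).
  by rewrite -[in RHS](expr1 varpi) exprnN; congr (_ ^ _); lia.
rewrite termE chi_residue_pow //; apply: contra id => /eqP e.
by apply/eqP/val_inj => /=; lia.
Qed.

(** Multiplying by the inverse of the leading coefficient and by varpi to the
    degree brings the leading term to varpi^-1. *)
Lemma chi_separates (P : {poly F}) : P != 0 ->
  exists z d, chi (lat_ev P * (f z * varpi ^+ d)) != 1.
Proof.
move=> P0; exists (lead_coef P)^-1, (size P).-1; rewrite chi_lat_ev -/(lead_coef P).
by rewrite divff ?lead_coef_eq0 // rmorph1 mul1r chi_varpiV.
Qed.

(** The expansion of u(qk) has no term in varpi^-1. *)
Lemma chi_u_qM k z : chi (u (q * k) * f z) = 1.
Proof.
have := chi_lat_ev (lat_poly (q * k)) z 0; rewrite expr0 mulr1 (lat_evE _ cardF) => ->.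
by rewrite (lat_polyMX cardF) coefXM /= mul0r rmorph0 mul0r chi0.
Qed.

(** A nontrivial additive character of GF(q) sums to zero: translating the
    index by z0 multiplies the sum by a number different from 1. *)
Lemma sum_chi_residue n : (forall k, n <> (q * k)%N) ->
  \sum_(s < q) chi (u n * f (residue s)) = 0.
Proof.
move=> nq; pose G z := chi (u n * f z).
rewrite -/(\sum_(s < q) G (residue s)).
have -> : \sum_(s < q) G (residue s) = \sum_z G z.
  rewrite [RHS](reindex (fun s : 'I_q => residue s)) //.
  exact: onW_bij (residue_bij pK cardF rangef).
have P0 : (lat_poly n)`_0 != 0.
  by apply/eqP => /(lat_poly_coef0 pK cardF) [k]; exact: nq.
set z0 := ((lat_poly n)`_0)^-1.
have w1 : G z0 != 1.
  have := chi_lat_ev (lat_poly n) z0 0; rewrite expr0 mulr1 (lat_evE _ cardF) /G => ->.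
  by rewrite divff // rmorph1 mul1r chi_varpiV.
have : G z0 * (\sum_z G z) = \sum_z G z.
  rewrite mulr_sumr [RHS](reindex_inj (addIr z0)); apply: eq_bigr => z _.
  by rewrite /G -chiD -mulrDr -rmorphD addrC.
move=> /eqP; rewrite -subr_eq0 -{2}[\sum_z G z]mul1r -mulrBl mulf_eq0.
by rewrite subr_eq0 (negbTE w1) => /eqP.
Qed.

End Characters.

(** * Fourier analysis on the ring of integers *)

Section Core.
Context {R : realType} {K : topologicalFieldType}.
Local Notation C := R[i].
Variables (mu : {measure set (borel K) -> \bar R}) (abs : K -> R).
Hypotheses (Kl : local_field K) (muH : haar_measure mu)
  (absH : haar_modulus mu abs) (mu_int : mu (int_ring abs) = 1%E).
Variables (p c : nat) (eps : 'I_c -> K) (varpi : K).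
Variables (F : finFieldType) (f : {rmorphism F -> K}).
Hypotheses (pK : p \in [pchar K]) (cardF : #|F| = (p ^ c)%N)
  (rangef : range f = prime_span eps) (varpi_prime : prime_element abs varpi)
  (eps0 : forall i : 'I_c, i = 0%N :> nat -> eps i = 1)
  (eps_int : forall i, int_ring abs (eps i)).
Variable chi : K -> C.
Hypothesis chi_basic : basic_character p eps varpi chi.

Local Notation q := (p ^ c)%N.
Local Notation u := (u p eps varpi).
Local Notation D := (int_ring abs).
Local Notation nsq := (nsq mu D).
Local Notation inner := (inner_on mu D).
Local Notation L2 := (L2_on mu D).
Local Notation unsh := (lat_unshift pK rangef).
Local Notation sq := (sqrtC (q%:R : C)).

Let varpi0 : varpi != 0. Proof. exact: (prime_element_neq0 Kl muH absH varpi_prime). Qed.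

Let chiD := chiD chi_basic.
Let chi0 := chi0 chi_basic.
Let chiN := chiN chi_basic.

Lemma int_ring_borel : measurable (D : set (borel K)).
Proof. by apply: open_borel; exact: (int_ring_open Kl muH absH pK). Qed.

Let mD := int_ring_borel.

Lemma int_ring_shift a : D a -> forall x, D (x + a) <-> D x.
Proof.
move=> Da x; split=> Dx; last exact: (int_ringD Kl muH absH pK).
rewrite -(addrK a x); apply: (int_ringD Kl muH absH pK) => //.
exact: (int_ringN Kl muH absH).
Qed.

(** Natural multiples of integers are integers, and so is the image of GF(q). *)
Lemma residue_int z : D (f z).
Proof.
have : prime_span eps (f z) by rewrite -rangef; exists z.
case=> a _ <-; elim/big_ind: _ => [|x y|i _].
- exact: (int_ring0 absH).
- exact: (int_ringD Kl muH absH pK).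
- apply: (int_ringM Kl muH absH) => //; elim: (a i) => [|n IH].
    exact: (int_ring0 absH).
  rewrite -natr1; apply: (int_ringD Kl muH absH pK) => //.
  exact: (int_ring1 Kl muH absH).
Qed.

Lemma varpi_u (s : 'I_q) : varpi * u s = f (residue p rangef s).
Proof. by rewrite (u_lt _ cardF rangef) // mulVKf. Qed.

Lemma varpi_u_int (s : 'I_q) : D (varpi * u s).
Proof. by rewrite varpi_u; exact: residue_int. Qed.

Lemma chi_cmeas b (A : set K) : measurable (A : set (borel K)) ->
  @cmeas _ (borel K) R A (fun xi => chi (b * xi)).
Proof.
move=> mA; apply: (@cmeasS _ (borel K) R A setT) => //.
case: chi_basic => -[cr ci] _ _ _; split.
  apply: (continuous_borel_real (f := fun x => complex.Re (chi (b * x)))) => x.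
  exact: continuous_comp (@mull_continuous K b x) (cr _).
apply: (continuous_borel_real (f := fun x => complex.Im (chi (b * x)))) => x.
exact: continuous_comp (@mull_continuous K b x) (ci _).
Qed.

Lemma one_L2 : L2 (fun=> 1).
Proof.
have [mr mi] := @cmeas_cst _ (borel K) R D 1; split => //.
rewrite /sqnorm_on (eq_integral (fun=> 1%:E)).
  by rewrite integral_cst // mul1e [X in (X < _)%E]mu_int ltry.
by move=> x _; rewrite /sqmod -/(sqn _) sqn_norm1 ?normr1.
Qed.

Lemma chi_L2M b g : L2 g -> L2 (fun xi => chi (b * xi) * g xi).
Proof.
move=> Lg; apply: (@L2M _ _ mu _ mD _ g 1) => //; first exact: chi_cmeas.
by move=> x _; rewrite (sqn_chi chi_basic).
Qed.

Lemma chi_L2 b : L2 (fun xi => chi (b * xi)).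
Proof. by have := chi_L2M b one_L2; under eq_fun do rewrite mulr1. Qed.

Lemma nsq_chiM b g : L2 g -> nsq (fun xi => chi (b * xi) * g xi) = nsq g.
Proof.
move=> Lg; rewrite /nsq; congr fine; apply: eq_integral => x _.
by rewrite /sqmod -!/(sqn _) sqnM (sqn_chi chi_basic) mul1r.
Qed.

(** Translating by an integer a multiplies the integral by chi(b a). *)
Lemma int_chi b : @cint _ (borel K) R mu D (fun xi => chi (b * xi)) =
  if `[< exists2 a, D a & chi (b * a) != 1 >] then 0 else 1.
Proof.
case: asboolP => [[a Da ba]|nba].
  have := cint_shift muH mD (int_ring_shift Da) (chi_cmeas b mD).
  have -> : (fun x : K => chi (b * (x + a))) = (fun x => chi (b * a) * chi (b * x)).
    by apply/funext => x; rewrite mulrDr chiD mulrC.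
  rewrite cintZ //; last first.
    have := L2_prod_integrable mD (chi_L2 b) one_L2.
    by under [X in cintegrable _ _ X]eq_fun do rewrite rmorph1 mulr1.
  move/eqP; rewrite -subr_eq0 -{2}[cint _ _ _]mul1r -mulrBl mulf_eq0.
  by rewrite subr_eq0 (negbTE ba) => /eqP.
transitivity (@cint _ (borel K) R mu D (fun=> 1)).
  apply: eq_cint => x; rewrite inE => Dx; apply/eqP/negPn/negP => bx.
  by apply: nba; exists x.
apply: complexP => /=.
  by rewrite (Rintegral_cst mu mD) mul1r [X in fine X]mu_int.
by rewrite (Rintegral_cst mu mD) mul0r.
Qed.

(** The functions in which the h^r_lj are expanded, chi_n being xi |-> chi(u(n)
    xi). *)
Definition echar n (xi : K) : C := (chi (u n * xi))^*.

Lemma echarE n xi : echar n xi = chi (- u n * xi).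
Proof. by rewrite /echar -chiN mulNr. Qed.

Lemma echar_fun n : echar n = (fun xi => chi (- u n * xi)).
Proof. by apply/funext => xi; rewrite echarE. Qed.

Lemma echar_L2 n : L2 (echar n).
Proof. by rewrite echar_fun; exact: chi_L2. Qed.

(** u(m) - u(n) is the lattice point of a polynomial that is nonzero for m <>
    n, and [chi_separates] provides an integer at which the corresponding
    character is nontrivial. *)
Lemma echar_orthonormal n m : inner (echar n) (echar m) = (n == m)%:R.
Proof.
have -> : inner (echar n) (echar m) =
    @cint _ (borel K) R mu D (fun xi => chi ((u m - u n) * xi)).
  apply: eq_cint => x _; rewrite echarE /echar conjCK -chiD; congr chi; ring.
rewrite int_chi; case: eqVneq => [->|nm].
  case: asboolP => // -[a _]; rewrite subrr mul0r chi0 eqxx //.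
rewrite asboolT //; set P := lat_poly p rangef m - lat_poly p rangef n.
have P0 : P != 0.
  rewrite subr_eq0; apply: contra nm => /eqP e.
  by apply/eqP/esym/(can_inj (lat_polyK pK cardF rangef)).
have [z [d zd]] := chi_separates pK cardF rangef varpi0 eps0 chi_basic P0.
exists (f z * varpi ^+ d).
  apply: (int_ringM Kl muH absH); first exact: residue_int.
  apply: (int_ringX Kl muH absH); case: varpi_prime => vlt _.
  by move: vlt; rewrite /max_ideal /int_ring /= => /ltW.
by rewrite -!(lat_evE varpi cardF rangef) -lat_evB.
Qed.

(** Averaging over the translates by the image of GF(q), up to the factor q. *)
Definition periodize (G : K -> C) xi := \sum_(s < q) G (xi + varpi * u s).

Lemma shift_L2 (s : 'I_q) G : L2 G -> L2 (fun xi => G (xi + varpi * u s)).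
Proof. move=> LG; exact: (L2_shift muH mD (int_ring_shift (varpi_u_int s)) LG). Qed.

Lemma periodize_L2 G : L2 G -> L2 (periodize G).
Proof. by move=> LG; apply: L2_sum => // s; exact: shift_L2. Qed.

Lemma echar_shift k (s : 'I_q) xi :
  echar (q * k) (xi + varpi * u s) = echar (q * k) xi.
Proof.
rewrite /echar mulrDr chiD varpi_u (chi_u_qM pK cardF rangef varpi0 chi_basic).
by rewrite mulr1.
Qed.

(** chi_(qk) is invariant under the translations involved, so each translate
    contributes the same. *)
Lemma inner_periodize G k : L2 G ->
  inner (periodize G) (echar (q * k)) = q%:R * inner G (echar (q * k)).
Proof.
move=> LG; rewrite (@inner_suml _ _ mu D mD _ _
  (fun s : 'I_q => fun xi => G (xi + varpi * u s))).
- rewrite (eq_bigr (fun=> inner G (echar (q * k)))).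
    by rewrite sumr_const card_ord mulr_natl.
  move=> s _; rewrite -[RHS](inner_shift muH mD (int_ring_shift (varpi_u_int s)) LG (echar_L2 _)).
  by apply: eq_cint => x _; rewrite echar_shift.
- by move=> s; exact: shift_L2.
- exact: echar_L2.
Qed.

(** Periodizing conj(chi_m) multiplies it by the sum of a character of GF(q),
    which vanishes unless q divides m. *)
Lemma periodize_echar_span m :
  clspan mu D (fun k => echar (q * k)) (periodize (echar m)).
Proof.
have Le k : L2 (echar (q * k)) by exact: echar_L2.
have perE : periodize (echar m) =
    (fun xi => (\sum_(s < q) (chi (u m * (varpi * u s)))^*) * echar m xi).
  apply/funext => xi; rewrite /periodize mulr_suml; apply: eq_bigr => s _.
  by rewrite /echar mulrDr chiD rmorphM mulrC.
have [[k mE]|nm] := pselect (exists k, m = (q * k)%N).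
  rewrite perE mE; apply: clspanZ => //; apply: comb_clspan => //.
  exact: (comb1 (fun k => echar (q * k))).
have S0 : \sum_(s < q) (chi (u m * (varpi * u s)))^* = 0.
  rewrite -rmorph_sum (eq_bigr (fun s : 'I_q => chi (u m * f (residue p rangef s)))).
    rewrite (sum_chi_residue pK cardF rangef varpi0 eps0 chi_basic) ?rmorph0 //.
    by move=> k mk; apply: nm; exists k.
  by move=> s _; rewrite varpi_u.
have -> : periodize (echar m) = (fun=> 0).
  by apply/funext => xi; rewrite perE S0 mul0r.
exact: clspan0.
Qed.

Lemma periodize_bounded : exists2 B : R, 0 < B & forall G, L2 G ->
  nsq (periodize G) <= B * nsq G.
Proof.
rewrite /periodize; elim: (index_enum _) => [|s r [B B0 IH]].
  exists 1 => // G LG; rewrite mul1r /nsq.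
  under [X in sqnorm_on _ _ X]eq_fun do rewrite big_nil.
  by rewrite sqnorm0 nsq_ge0.
exists (2 + 2 * B) => [|G LG]; first by rewrite addr_gt0 // mulr_gt0.
have Lr : L2 (fun xi => \sum_(s <- r) G (xi + varpi * u s)).
  by apply: L2_sum => // i; exact: shift_L2.
have -> : (fun xi => \sum_(i <- s :: r) G (xi + varpi * u i)) =
    (fun xi => G (xi + varpi * u s) + \sum_(i <- r) G (xi + varpi * u i)).
  by apply/funext => xi; rewrite big_cons.
have := nsqD_le2 mD (shift_L2 s LG) Lr.
move=> /le_trans; apply.
have -> : (2 + 2 * B) * nsq G = 2 * nsq G + 2 * (B * nsq G) by ring.
apply: lerD.
  rewrite ler_wpM2l // /nsq (sqnorm_shift muH mD (int_ring_shift (varpi_u_int s)) LG) //.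
by rewrite ler_wpM2l // IH.
Qed.

(** Periodization is linear and bounded on L^2. *)
Lemma periodize_span G : clspan mu D echar G ->
  clspan mu D (fun k => echar (q * k)) (periodize G).
Proof.
have Le k : L2 (echar (q * k)) by exact: echar_L2.
move=> [LG cG]; apply: clspan_lim => //; first exact: periodize_L2.
move=> e e0; have [B B0 BP] := periodize_bounded.
have [g cg Gg] := cG (e / B) ltac:(by rewrite divr_gt0).
have Lg := comb_L2 mD echar_L2 cg.
exists (periodize g).
  case: cg => s ->.
  have -> : periodize (fun t => \sum_(z <- s) z.1 * echar z.2 t) =
      (fun t => \sum_(z <- s) z.1 * periodize (echar z.2) t).
    apply/funext => t; rewrite /periodize exchange_big; apply: eq_bigr => z _.
    by rewrite mulr_sumr.
  by apply: clspan_sum => // z; apply: clspanZ => //; exact: periodize_echar_span.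
have -> : (fun t => periodize G t - periodize g t) = periodize (fun t => G t - g t).
  by apply/funext => t; rewrite /periodize sumrB.
apply: le_lt_trans (BP _ (L2B mD LG Lg)) _.
by rewrite mulrC -ltr_pdivlMr.
Qed.

Lemma echar_mulJ i k m xi : u m = u i - u k ->
  echar i xi * (echar k xi)^* = echar m xi.
Proof. by move=> um; rewrite !echarE -chiN -chiD um; congr chi; ring. Qed.

Lemma u_sub i k : exists m, u m = u i - u k.
Proof.
exists (lat_index pK rangef (lat_poly p rangef i - lat_poly p rangef k)).
by rewrite -!(lat_evE varpi cardF rangef) lat_indexK // lat_evB.
Qed.

Let sqJV : (sq^-1)^* = sq^-1. Proof. by rewrite fmorphV /= conj_sqrtC. Qed.

Let q_gt0 : 0 < q%:R :> R.
Proof. by rewrite ltr0n -cardF; apply/card_gt0P; exists 0. Qed.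

Section Series.
Variables (h0 : K -> C) (a : nat -> C).
Hypothesis h0s : L2_series_on mu D
  (fun k xi => sq^-1 * (a k * (chi (u k * xi))^*)) h0.

Let Lh : L2 h0. Proof. by case: h0s. Qed.

Let term_L2 k : L2 (fun xi => sq^-1 * (a k * echar k xi)).
Proof. by do 2 apply: L2Z => //; exact: echar_L2. Qed.

Let inner_term k m : inner (fun xi => sq^-1 * (a k * echar k xi)) (echar m) =
  sq^-1 * (a k * inner (echar k) (echar m)).
Proof.
have Lk := echar_L2 k; have Lm := echar_L2 m.
by rewrite (innerZl mD _ (L2Z mD _ Lk) Lm) (innerZl mD _ Lk Lm).
Qed.

Lemma inner_series m : inner h0 (echar m) = sq^-1 * a m.
Proof.
apply/eqP; rewrite -subr_eq0; apply/eqP/sqn_eq0/eqP; rewrite eq_le sqn_ge0 andbT.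
apply/ler_addgt0Pr => e e0; rewrite add0r.
have [n nP] := L2_series_tail mD h0s term_L2 e0.
pose M := maxn n m.+1; have mM : (m < M)%N by rewrite leq_maxr.
have := nP M (leq_maxl _ _); rewrite -/(echar _ _) => /ltW h0M.
have LS : L2 (fun xi => \sum_(k < M) sq^-1 * (a k * echar k xi)).
  by apply: L2_sum => // k; exact: term_L2.
have := inner_le_approx mD Lh LS (echar_L2 m) h0M.
have -> : nsq (echar m) = 1.
  by apply: complexI; rewrite -innerff ?echar_orthonormal ?eqxx //; exact: echar_L2.
rewrite mulr1; congr (sqn (_ - _) <= _).
rewrite (@inner_suml _ _ mu D mD _ _ (fun k : 'I_M => fun xi => sq^-1 * (a k * echar k xi))).
- rewrite (bigD1 (Ordinal mM)) //= big1 ?addr0 => [|k km].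
    by rewrite inner_term echar_orthonormal eqxx mulr1.
  rewrite inner_term echar_orthonormal.
  rewrite (_ : (val k == m) = false) ?mulr0 ?mulr0 //.
  by apply: contraNF km => /eqP e1; apply/eqP/val_inj.
- by move=> k; exact: term_L2.
- exact: echar_L2.
Qed.

Lemma conj_mul_echar_L2 i : L2 (fun xi => (h0 xi)^* * echar i xi).
Proof.
under eq_fun do rewrite mulrC.
by rewrite echar_fun; apply: chi_L2M; exact: L2J.
Qed.

(** h0 is an L^2 limit of trigonometric polynomials, and multiplication by a
    character of modulus 1 preserves both distances and trigonometric
    polynomials. *)
Lemma conj_mul_echar_span i : clspan mu D echar (fun xi => (h0 xi)^* * echar i xi).
Proof.
apply: clspan_lim => //; [exact: echar_L2|exact: conj_mul_echar_L2|].
move=> e e0; have [n nP] := L2_series_tail mD h0s term_L2 e0.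
pose S xi := \sum_(k < n) sq^-1 * (a k * echar k xi).
have LS : L2 S by apply: L2_sum => // k; exact: term_L2.
exists (fun xi => (S xi)^* * echar i xi).
  have -> : (fun xi => (S xi)^* * echar i xi) =
     (fun xi => \sum_(k < n) (sq^-1 * a k)^* * (echar i xi * (echar k xi)^*)).
    apply/funext => xi; rewrite /S rmorph_sum mulr_suml; apply: eq_bigr => k _.
    by rewrite mulrA rmorphM -mulrA; congr (_ * _); rewrite mulrC.
  apply: clspan_sum => // [|k]; first exact: echar_L2.
  apply: clspanZ => //; first exact: echar_L2.
  have [m um] := u_sub i k.
  rewrite (_ : (fun xi => _) = echar m); last by apply/funext => xi; exact: echar_mulJ.
  by apply: comb_clspan => //; [exact: echar_L2|exact: comb1].
have -> : (fun xi => (h0 xi)^* * echar i xi - (S xi)^* * echar i xi) =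
    (fun xi => chi (- u i * xi) * (h0 xi - S xi)^*).
  by apply/funext => xi; rewrite -mulrBl -rmorphB mulrC echarE.
rewrite nsq_chiM; last by apply: L2J => //; exact: L2B.
rewrite (_ : nsq _ = nsq (fun xi => h0 xi - S xi)); first exact: nP.
by rewrite /nsq; congr fine; apply: eq_integral => x _; rewrite /sqmod -!/(sqn _) sqnJ.
Qed.

(** The coefficients of conj(h0) are conjugated and reflected: the product of
    conj(chi_i) and chi_(qk) is the conjugate character of u(i) - u(qk). *)
Lemma inner_conj_mul_echar i k :
  inner (fun xi => (h0 xi)^* * echar i xi) (echar (q * k)) = sq^-1 * (a (unsh k i))^*.
Proof.
transitivity ((inner h0 (echar (unsh k i)))^*); last first.
  by rewrite inner_series rmorphM /= sqJV.
rewrite /inner_on -cintJ //; last first.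
  by apply: L2_prod_integrable => //; exact: echar_L2.
apply: eq_cint => x _; rewrite -mulrA rmorphM /=; congr (_ * _).
rewrite (@echar_mulJ i (q * k) (unsh k i)); last exact: u_unshift.
by rewrite [RHS]conjCK.
Qed.

End Series.

Section Family.
Variables (N n : nat) (a : 'I_N -> nat -> C) (h0 : 'I_N -> K -> C) (b : 'I_N -> nat -> C).
Hypothesis h0s : forall j, L2_series_on mu D
  (fun k xi => sq^-1 * (a j k * (chi (u k * xi))^*)) (h0 j).

Definition trig_poly (b0 : nat -> C) xi := \sum_(i < n) b0 i * echar i xi.

(** Its coefficients on the characters conj(chi_i) are q^(-1/2) times the
    correlations of b with the filters. *)
Definition filtered xi := \sum_(j < N) (h0 j xi)^* * trig_poly (b j) xi.

(** The value at qk of the correlation of the coefficients b, truncated to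
    indices below n, with the filters a. *)
Definition decimated k := \sum_(i < n) \sum_(j < N) (a j (unsh k i))^* * b j i.

Lemma trig_poly_L2 b0 : L2 (trig_poly b0).
Proof. by apply: L2_sum => // i; apply: L2Z => //; exact: echar_L2. Qed.

Lemma sqnorm_trig_poly b0 :
  sqnorm_on mu D (trig_poly b0) = (\sum_(i < n) sqn (b0 i))%:E.
Proof.
rewrite sqnormE; last exact: trig_poly_L2.
congr EFin; apply: complexI; rewrite -(innerff mD (trig_poly_L2 b0)).
have inn (i : 'I_n) : inner (trig_poly b0) (echar i) = b0 i.
  rewrite (@inner_suml _ _ mu D mD _ _ (fun i : 'I_n => fun xi => b0 i * echar i xi)).
  - rewrite (bigD1 i) //= (innerZl mD _ (echar_L2 _) (echar_L2 _)).
    rewrite echar_orthonormal eqxx mulr1 big1 ?addr0 // => k ki.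
    rewrite (innerZl mD _ (echar_L2 _) (echar_L2 _)) echar_orthonormal.
    by rewrite (_ : (val k == val i) = false) ?mulr0 //; apply: negbTE.
  - by move=> k; apply: L2Z => //; exact: echar_L2.
  - exact: echar_L2.
rewrite [X in inner _ X]/trig_poly.
rewrite (@inner_sumr _ _ mu D mD _ _ (fun i : 'I_n => fun xi => b0 i * echar i xi)).
- rewrite sum_sqnC; apply: eq_bigr => i _.
  by rewrite (innerZr mD (b0 i) (echar_L2 i) (trig_poly_L2 b0)) inn mulrC.
- by move=> k; apply: L2Z => //; exact: echar_L2.
- exact: trig_poly_L2.
Qed.

Let filteredE : filtered =
  (fun xi => \sum_(i < n) \sum_(j < N) b j i * ((h0 j xi)^* * echar i xi)).
Proof.
apply/funext => xi; rewrite exchange_big; apply: eq_bigr => j _.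
by rewrite mulr_sumr; apply: eq_bigr => i _; rewrite mulrCA.
Qed.

Lemma filtered_L2 : L2 filtered.
Proof.
rewrite filteredE; apply: L2_sum => // i; apply: L2_sum => // j; apply: L2Z => //.
exact: conj_mul_echar_L2 (h0s j) i.
Qed.

Lemma filtered_span : clspan mu D echar filtered.
Proof.
rewrite filteredE; apply: clspan_sum => // [|i]; first exact: echar_L2.
apply: clspan_sum => // [|j]; first exact: echar_L2.
apply: clspanZ => //; first exact: echar_L2.
exact: conj_mul_echar_span (h0s j) i.
Qed.

Lemma inner_filtered k : inner filtered (echar (q * k)) = sq^-1 * decimated k.
Proof.
have Lij (i : 'I_n) (j : 'I_N) : L2 (fun xi => (h0 j xi)^* * echar i xi).
  exact: conj_mul_echar_L2 (h0s j) i.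
rewrite filteredE.
rewrite (@inner_suml _ _ mu D mD _ _ (fun i : 'I_n => fun xi =>
  \sum_(j < N) b j i * ((h0 j xi)^* * echar i xi))); last 2 first.
- by move=> i; apply: L2_sum => // j; exact: L2Z.
- exact: echar_L2.
rewrite /decimated mulr_sumr; apply: eq_bigr => i _.
rewrite (@inner_suml _ _ mu D mD _ _ (fun j : 'I_N => fun xi =>
  b j i * ((h0 j xi)^* * echar i xi))); last 2 first.
- by move=> j; exact: L2Z.
- exact: echar_L2.
rewrite mulr_sumr; apply: eq_bigr => j _.
rewrite innerZl //; last exact: echar_L2.
by rewrite (inner_conj_mul_echar (h0s j)) mulrCA [b j i * _]mulrC.
Qed.

(** By [inner_periodize] and [inner_filtered] the coefficients of the
    periodized function on the orthonormal characters conj(chi_(qk)) are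
    q^(1/2) times the decimated outputs. *)
Lemma decimated_parseval :
  ((q%:R)%:E * \sum_(0 <= k <oo) sqmod (decimated k) =
   sqnorm_on mu D (periodize filtered))%E.
Proof.
rewrite -nneseriesZl; last by move=> k _; rewrite lee_fin sqn_ge0.
rewrite -(@parseval _ _ mu D mD (fun k => echar (q * k))).
- apply: eq_eseriesr => k _; rewrite inner_periodize; last exact: filtered_L2.
  rewrite inner_filtered mulrA /sqmod -!/(sqn _) -EFinM; congr EFin.
  rewrite [in RHS]sqnM; congr (_ * _).
  have q0 : (q%:R : C) != 0.
    by rewrite pnatr_eq0 -lt0n; move: q_gt0; rewrite ltr0n.
  have -> : (q%:R : C) * sq^-1 = sq.
    by rewrite -{1}[q%:R]sqrtCK expr2 mulfK // sqrtC_eq0.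
  by rewrite sqn_sqrtC.
- by move=> k; exact: echar_L2.
- move=> i j; rewrite echar_orthonormal eqn_pmul2l //.
  by move: q_gt0; rewrite ltr0n.
- exact: periodize_span filtered_span.
Qed.

End Family.

Section MatrixBounds.
Variables (N n : nat) (a : 'I_q -> 'I_N -> 'I_N -> nat -> C)
  (h : 'I_q -> 'I_N -> 'I_N -> K -> C) (b : 'I_N -> nat -> C).
Hypothesis hs : forall r l j, L2_series_on mu D
  (fun k xi => sq^-1 * (a r l j k * (chi (u k * xi))^*)) (h r l j).

Let SG xi : R := \sum_(r < q) \sum_(l < N) sqn (periodize (filtered n (h r l) b) xi).
Let SC xi : R := \sum_(s < q) \sum_(j < N) sqn (trig_poly n (b j) (xi + varpi * u s)).
Let G xi := gram (H_matrix varpi u h xi).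

(** The conjugate of the periodized filtered function is the (r,l) entry of
    H(xi) applied to the conjugated values of the trigonometric polynomials at
    the points xi + varpi u(s). *)
Lemma H_matrix_filtered xi :
  min_eigenvalue (G xi) * SC xi <= SG xi <= max_eigenvalue (G xi) * SC xi.
Proof.
pose w (s : 'I_q) j := (trig_poly n (b j) (xi + varpi * u s))^*.
have -> : SC xi = \sum_(s < q) \sum_(j < N) sqn (w s j).
  by apply: eq_bigr => s _; apply: eq_bigr => j _; rewrite sqnJ.
have -> : SG xi = \sum_(r < q) \sum_(l < N)
    sqn (\sum_(s < q) \sum_(j < N) h r l j (xi + varpi * u s) * w s j).
  apply: eq_bigr => r _; apply: eq_bigr => l _; rewrite -sqnJ; congr sqn.
  rewrite /periodize rmorph_sum; apply: eq_bigr => s _.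
  rewrite /filtered rmorph_sum; apply: eq_bigr => j _.
  by rewrite rmorphM /= conjCK.
exact: H_matrix_bounds.
Qed.

Let SG0 xi : 0 <= SG xi.
Proof. by do 2 (apply: sumr_ge0 => ? _); exact: sqn_ge0. Qed.

Let SC0 xi : 0 <= SC xi.
Proof. by do 2 (apply: sumr_ge0 => ? _); exact: sqn_ge0. Qed.

Let Lper r l : L2 (periodize (filtered n (h r l) b)).
Proof. by apply: periodize_L2; exact: filtered_L2 (hs r l). Qed.

Let Lsh (s : 'I_q) j : L2 (fun xi => trig_poly n (b j) (xi + varpi * u s)).
Proof. by apply: shift_L2; exact: trig_poly_L2. Qed.

Let mSG : measurable_fun (D : set (borel K)) (EFin \o SG : borel K -> \bar R).
Proof.
apply/measurable_EFinP; apply: measurable_sum => r; apply: measurable_sum => l.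
exact: cmeas_sqn (L2_cmeas (Lper r l)).
Qed.

Let mSC (k : R) : measurable_fun (D : set (borel K))
  ((fun xi => (k * SC xi)%:E) : borel K -> \bar R).
Proof.
apply/measurable_EFinP; apply: measurable_funM => //.
apply: measurable_sum => s; apply: measurable_sum => j.
exact: cmeas_sqn (L2_cmeas (Lsh s j)).
Qed.

Let intSG : (\int[mu]_(x in (D : set (borel K))) (SG x)%:E =
  (q%:R)%:E * \sum_(r < q) \sum_(l < N)
    \sum_(0 <= k <oo) sqmod (decimated n (a r l) b k))%E.
Proof.
rewrite ge0_sume_distrr; last first.
  move=> r _; apply: sume_ge0 => l _; apply: nneseries_ge0 => k _ _.
  by rewrite lee_fin sqn_ge0.
under eq_integral do rewrite /SG -sumEFin.
rewrite ge0_integral_sum //; last 2 first.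
- move=> r; apply/measurable_EFinP; apply: measurable_sum => l.
  exact: cmeas_sqn (L2_cmeas (Lper r l)).
- by move=> r x _; rewrite lee_fin sumr_ge0 // => l _; exact: sqn_ge0.
apply: eq_bigr => r _; rewrite ge0_sume_distrr; last first.
  by move=> l _; apply: nneseries_ge0 => k _ _; rewrite lee_fin sqn_ge0.
under eq_integral do rewrite -sumEFin.
rewrite ge0_integral_sum //; last 2 first.
- move=> l; exact: cmeas_sqmod (L2_cmeas (Lper r l)).
- by move=> l x _; rewrite lee_fin sqn_ge0.
by apply: eq_bigr => l _; rewrite (decimated_parseval n b (hs r l)).
Qed.

Let intSC (k : R) : 0 <= k -> (\int[mu]_(x in (D : set (borel K))) (k * SC x)%:E =
  (q%:R)%:E * (k * \sum_(j < N) \sum_(i < n) sqn (b j i))%:E)%E.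
Proof.
move=> k0; under eq_integral do rewrite EFinM.
rewrite ge0_integralZl //; last 2 first.
- by have := mSC 1; under eq_fun do rewrite mul1r.
- by move=> x _; rewrite lee_fin.
rewrite EFinM muleCA; congr (_ * _)%E.
under eq_integral do rewrite /SC -sumEFin.
rewrite ge0_integral_sum //; last 2 first.
- move=> s; apply/measurable_EFinP; apply: measurable_sum => j.
  exact: cmeas_sqn (L2_cmeas (Lsh s j)).
- by move=> r x _; rewrite lee_fin sumr_ge0 // => l _; exact: sqn_ge0.
rewrite (eq_bigr (fun=> (\sum_(j < N) \sum_(i < n) sqn (b j i))%:E)).
  by rewrite sumEFin -EFinM sumr_const card_ord mulr_natl.
move=> s _; under eq_integral do rewrite -sumEFin.
rewrite ge0_integral_sum //; last 2 first.
- move=> j; exact: cmeas_sqmod (L2_cmeas (Lsh s j)).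
- by move=> l x _; rewrite lee_fin sqn_ge0.
rewrite -sumEFin; apply: eq_bigr => j _; rewrite -sqnorm_trig_poly.
exact: (sqnorm_shift muH mD (int_ring_shift (varpi_u_int s)) (trig_poly_L2 n (b j))).
Qed.

(** Integrate [H_matrix_filtered] over the ring of integers, which is invariant
    under the translations by varpi u(s). *)
Lemma decimated_lower (lam : R) : 0 <= lam ->
  {ae mu, forall xi : borel K, lam <= min_eigenvalue (G xi)} ->
  ((lam * \sum_(j < N) \sum_(i < n) sqn (b j i))%:E <=
   \sum_(r < q) \sum_(l < N) \sum_(0 <= k <oo) sqmod (decimated n (a r l) b k))%E.
Proof.
move=> lam0 laml; rewrite -(@lee_pmul2l _ (q%:R)%:E) ?lte_fin //.
rewrite -intSC // -intSG; apply: ae_ge0_le_integral => //.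
- by move=> x _; rewrite lee_fin mulr_ge0.
- by move=> x _; rewrite lee_fin.
apply: filterS laml => xi le _; rewrite lee_fin.
have /andP[le2 _] := H_matrix_filtered xi.
by apply: le_trans le2; rewrite ler_wpM2r.
Qed.

Lemma decimated_upper (Lam : R) : 0 <= Lam ->
  {ae mu, forall xi : borel K, max_eigenvalue (G xi) <= Lam} ->
  (\sum_(r < q) \sum_(l < N) \sum_(0 <= k <oo) sqmod (decimated n (a r l) b k) <=
   (Lam * \sum_(j < N) \sum_(i < n) sqn (b j i))%:E)%E.
Proof.
move=> Lam0 Laml; rewrite -(@lee_pmul2l _ (q%:R)%:E) ?lte_fin //.
rewrite -intSC // -intSG; apply: ae_ge0_le_integral => //.
- by move=> x _; rewrite lee_fin.
- by move=> x _; rewrite lee_fin mulr_ge0.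
apply: filterS Laml => xi le _; rewrite lee_fin.
have /andP[_ le2] := H_matrix_filtered xi.
by apply: le_trans le2 _; rewrite ler_wpM2r.
Qed.

End MatrixBounds.

End Core.

(** * The Bessel inequality of the frame *)

Section FrameBessel.
Context {R : realType} {K : topologicalFieldType}.
Local Notation C := R[i].
Variable mu : {measure set (borel K) -> \bar R}.
Local Notation L2 := (L2_on mu [set: K]).
Local Notation nsq := (nsq mu [set: K]).
Local Notation inner := (inner_on mu [set: K]).

Let mT : measurable ([set: K] : set (borel K)). Proof. exact: measurableT. Qed.

(** For f the combination with coefficients a, the sum of the |<f,x_i> - C2
    a_i|^2 is nonnegative. Expanding it, with sum of conj(a_i) <f,x_i> = |f|^2
    and the frame bound for f, gives |f|^2 <= C2 sum |a_i|^2. *)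
Lemma synthesis_bound (I : countType) (x : I -> K -> C) :
  (forall i, L2 (x i)) -> frame_for mu (closed_lin_span mu x) x ->
  exists2 B : R, 0 < B & forall (s : seq I) (a : I -> C), uniq s ->
    nsq (fun t => \sum_(i <- s) a i * x i t) <= B * \sum_(i <- s) sqn (a i).
Proof.
move=> Lx [_ [C1 [C2 [C10 C12 fr]]]].
have C20 : 0 < C2 by exact: lt_le_trans C12.
exists C2 => // s a us; set f := fun t => _.
have Lf : L2 f by apply: L2_sum => // i; exact: L2Z.
have fspan : closed_lin_span mu x f.
  split=> // e e0; exists f; first by exists s, a.
  under [X in sqnorm_on _ _ X]eq_fun do rewrite subrr.
  by rewrite sqnorm0 lte_fin.
have [_ up] := fr f fspan.
have sumle : \sum_(i <- s) sqn (inner f (x i)) <= C2 * nsq f.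
  rewrite -lee_fin EFinM -(sqnormE Lf); apply: le_trans up.
  apply: esum_ge; exists [set` s]; first by split => //; exact: finite_seq.
  by rewrite -(fsbig_seq _ _ us) -sumEFin.
have innE : inner f f = \sum_(i <- s) (a i)^* * inner f (x i).
  rewrite (@inner_sumr _ _ mu _ mT _ s (fun i t => a i * x i t) f) //.
    by apply: eq_bigr => i _; rewrite innerZr.
  by move=> i; exact: L2Z.
have reE : \sum_(i <- s) complex.Re ((a i)^* * inner f (x i)) = nsq f.
  have : complex.Re (inner f f) = nsq f by rewrite innerff.
  by rewrite innE (big_morph (@complex.Re R) (@ReD R) (erefl _)).
have : 0 <= \sum_(i <- s) sqn (inner f (x i) - C2%:C%C * a i).
  by apply: sumr_ge0 => i _; exact: sqn_ge0.
have sqnB (z w : C) : sqn (z - C2%:C%C * w) =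
    sqn z - 2 * C2 * complex.Re (w^* * z) + C2 ^+ 2 * sqn w.
  by rewrite /sqn ?(ReD, ImD, ReN, ImN, ReM, ImM, ReJ, ImJ) /=; ring.
under eq_bigr do rewrite sqnB.
rewrite big_split sumrB -!mulr_sumr /= reE.
move: sumle; set A := \sum_(i <- s) sqn (a i); set S := nsq f; set T := \sum_(i <- s) _.
move=> le1 le2; rewrite -(ler_pM2l C20); move: le1 le2; rewrite expr2; lra.
Qed.

(** With a_i = <g,y_i> and f the combination with coefficients a, expand |g -
    f/B|^2 >= 0. This covers every g in L^2, whereas the frame inequality is
    stated on the closed span only. *)
Lemma bessel_of_synthesis (I : eqType) (y : I -> K -> C) (B : R) : 0 < B ->
  (forall i, L2 (y i)) ->
  (forall (s : seq I) (a : I -> C), uniq s ->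
    nsq (fun t => \sum_(i <- s) a i * y i t) <= B * \sum_(i <- s) sqn (a i)) ->
  forall g, L2 g -> forall s : seq I, uniq s ->
  \sum_(i <- s) sqn (inner g (y i)) <= B * nsq g.
Proof.
move=> B0 Ly syn g Lg s us; pose a i := inner g (y i).
have := syn s a us; set f := fun t => _ => fB.
have Lf : L2 f by apply: L2_sum => // i; exact: L2Z.
have innE : inner g f = (\sum_(i <- s) sqn (a i))%:C%C.
  rewrite (@inner_sumr _ _ mu _ mT _ s (fun i t => a i * y i t) g) //.
    rewrite rmorph_sum; apply: eq_bigr => i _.
    by rewrite innerZr //= sqnC mulrC.
  by move=> i; exact: L2Z.
have := nsq_ge0 mu [set: K] (fun t => g t - (B^-1)%:C%C * f t).
rewrite nsqB // innE /=; move: fB; rewrite -/a.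
set A := \sum_(i <- s) sqn (a i); set T := nsq f => TB pos.
have : 0 <= B * (nsq g - B^-1 * (2 * A) + B^-1 ^+ 2 * (B * A)).
  apply: mulr_ge0; first exact: ltW.
  by apply: le_trans pos _; rewrite lerD2l ler_wpM2l // sqr_ge0.
have -> : B * (nsq g - B^-1 * (2 * A) + B^-1 ^+ 2 * (B * A)) = B * nsq g - A.
  by field; exact: lt0r_neq0.
by rewrite subr_ge0.
Qed.

Section Dilated.
Variable abs : K -> R.
Hypotheses (absH : haar_modulus mu abs) (abs_ge0 : forall x, 0 <= abs x).
Variables (b : K) (z : C).
Hypothesis b0 : b != 0.

(** Dilation and scaling multiply the square norm of a combination by a
    constant factor. *)
Lemma synthesis_bound_dilate (I : countType) (x : I -> K -> C) :
  (forall i, L2 (x i)) -> frame_for mu (closed_lin_span mu x) x ->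
  exists2 B : R, 0 < B & forall (s : seq I) (a : I -> C), uniq s ->
    nsq (fun t => \sum_(i <- s) a i * (z * x i (b * t))) <= B * \sum_(i <- s) sqn (a i).
Proof.
move=> Lx fr; have [B B0 BP] := synthesis_bound Lx fr.
have k0 : 0 <= sqn z * abs b^-1 by rewrite mulr_ge0 // sqn_ge0.
exists ((sqn z * abs b^-1 + 1) * B) => [|s a us]; first by rewrite mulr_gt0 // ltr_wpDl.
pose f t := \sum_(i <- s) a i * x i t.
have Lf : L2 f by apply: L2_sum => // i; exact: L2Z.
have -> : (fun t => \sum_(i <- s) a i * (z * x i (b * t))) = (fun t => z * f (b * t)).
  by apply/funext => t; rewrite mulr_sumr; apply: eq_bigr => i _; rewrite mulrCA.
have Ld : L2 (fun t => f (b * t)) by exact: (L2_dilate absH abs_ge0 b0 Lf).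
rewrite nsqZ //.
have -> : nsq (fun t => f (b * t)) = abs b^-1 * nsq f.
  apply: EFin_inj; rewrite -(sqnormE Ld) (sqnorm_dilate absH abs_ge0 b0 Lf).
  by rewrite (sqnormE Lf) -EFinM.
have := BP s a us; rewrite -/f => fB.
rewrite [leLHS]mulrA -[leRHS]mulrA; apply: ler_pM => //; first exact: nsq_ge0.
by rewrite lerDl.
Qed.

End Dilated.
End FrameBessel.

Section Coefficients.
Context {R : realType} {K : topologicalFieldType}.
Local Notation C := R[i].
Variable mu : {measure set (borel K) -> \bar R}.
Local Notation L2 := (L2_on mu [set: K]).
Local Notation nsq := (nsq mu [set: K]).
Local Notation inner := (inner_on mu [set: K]).
Hypothesis muH : haar_measure mu.

Let mT : measurable ([set: K] : set (borel K)). Proof. exact: measurableT. Qed.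

(** Translation is an isometry and the inner product is continuous. *)
Lemma inner_shift_series (t : nat -> K -> C) psi g (a : K) :
  L2_series_on mu [set: K] t psi -> (forall m, L2 (t m)) -> L2 g ->
  forall e : R, 0 < e -> exists n0, forall n, (n0 <= n)%N ->
  sqn (inner g (fun x => psi (x - a)) - \sum_(m < n) inner g (fun x => t m (x - a))) < e.
Proof.
move=> ps Lt Lg e e0; have Lpsi : L2 psi by case: ps.
have g0 : 0 < nsq g + 1 by rewrite ltr_wpDl // nsq_ge0.
have [n0 n0P] := L2_series_tail mT ps Lt (divr_gt0 e0 g0).
exists n0 => n nn0; have Aa x : [set: K] (x + - a) <-> [set: K] x by [].
have Lsh f : L2 f -> L2 (fun x => f (x - a)) by exact: (L2_shift muH mT Aa).
pose S x := \sum_(m < n) t m x.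
have LS : L2 S by apply: L2_sum => // m; exact: Lt.
have nsqE : nsq (fun x => psi (x - a) - S (x - a)) = nsq (fun x => psi x - S x).
  by rewrite /nsq (sqnorm_shift muH mT Aa (L2B mT Lpsi LS)).
have := inner_le_approx mT (Lsh _ Lpsi) (Lsh _ LS) Lg (lexx _).
rewrite nsqE [inner (fun x => psi _) g]innerJ //; last exact: Lsh.
rewrite [inner (fun x => S _) g]innerJ //; last exact: Lsh.
rewrite -rmorphB sqnJ.
rewrite (@inner_sumr _ _ mu _ mT _ _ (fun m : 'I_n => fun x => t m (x - a)) g) //; last first.
  by move=> m; exact: Lsh.
move=> /le_lt_trans; apply.
have := n0P n nn0; rewrite -/(S _) ltr_pdivlMr //; apply: le_lt_trans.
by rewrite ler_wpM2l ?nsq_ge0 // lerDl.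
Qed.

End Coefficients.

(** * Passing from truncated to infinite sequences *)

Section TruncationLimit.
Context {R : realType}.
Local Notation C := R[i].

(** Choose t small first, then e small in terms of t. *)
Lemma le_of_weighted (y V : R) : 0 <= V ->
  (forall t e : R, 0 < t -> 0 < e -> y <= (1 + t) * V + (1 + t^-1) * e) -> y <= V.
Proof.
move=> V0 yP; apply/ler_addgt0Pr => e e0.
pose t := e / (2 * (V + 1)).
have V1 : 0 < V + 1 by rewrite ltr_wpDl.
have t0 : 0 < t by rewrite divr_gt0 // mulr_gt0.
have t1 : 0 < 1 + t^-1 by rewrite addr_gt0 // invr_gt0.
have := yP t (e / 2 / (1 + t^-1)) t0; rewrite !divr_gt0 // => /(_ isT).
rewrite [(1 + t^-1) * _]mulrC divfK ?gt_eqF // => /le_trans; apply.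
have -> : (1 + t) * V = V + t * V by ring.
rewrite -addrA lerD2l [X in _ <= X](splitr e) lerD2r /t mulrAC.
rewrite ler_pdivrMr ?mulr_gt0 //.
have -> : e / 2 * (2 * (V + 1)) = e * (V + 1) by field.
by rewrite ler_wpM2l ?ltW // ltrDl.
Qed.

Lemma sqmod_ge0 (z : C) : (0 <= sqmod z)%E.
Proof. by rewrite lee_fin; exact: sqn_ge0. Qed.

Definition psum (J : finType) (z : J -> nat -> C) M : R :=
  \sum_j \sum_(k < M) sqn (z j k).

Lemma psum_ge0 (J : finType) (z : J -> nat -> C) M : 0 <= psum z M.
Proof. by do 2 (apply: sumr_ge0 => ? _); exact: sqn_ge0. Qed.

Lemma psum_le (J : finType) (z : J -> nat -> C) M M' : (M <= M')%N ->
  psum z M <= psum z M'.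
Proof.
move=> MM'; apply: ler_sum => j _; rewrite -!(big_mkord xpredT (fun k => sqn (z j k))).
rewrite (big_cat_nat (n := M) (p := M')) //= lerDl sumr_ge0 // => k _.
exact: sqn_ge0.
Qed.

Lemma psum_weighted (J : finType) (z z' : J -> nat -> C) M (t : R) : 0 < t ->
  psum z M <= (1 + t) * psum z' M + (1 + t^-1) * psum (fun j k => z j k - z' j k) M.
Proof.
move=> t0; rewrite /psum !mulr_sumr -big_split; apply: ler_sum => j _ /=.
rewrite !mulr_sumr -big_split; apply: ler_sum => k _ /=.
by rewrite -{1}[z j k](subrKC (z' j k)) addrC addrC; exact: sqnD_le.
Qed.

Lemma psum_series_ge (J : finType) (z : J -> nat -> C) M :
  ((psum z M)%:E <= \sum_j \sum_(0 <= k <oo) sqmod (z j k))%E.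
Proof.
rewrite -sumEFin; apply: lee_sum => j _.
rewrite -sumEFin -(big_mkord xpredT (fun k => sqmod (z j k))).
by apply: nneseries_lim_ge => k _ _; rewrite lee_fin sqn_ge0.
Qed.

Lemma psum_series_le (J : finType) (z : J -> nat -> C) (V : \bar R) :
  (forall M, ((psum z M)%:E <= V)%E) ->
  (\sum_j \sum_(0 <= k <oo) sqmod (z j k) <= V)%E.
Proof.
move=> zV; rewrite -nneseries_sum; last first.
  by move=> *; exact: sqmod_ge0.
apply: lime_le.
  by apply: is_cvg_nneseries => k _ _; apply: sume_ge0 => j _; rewrite lee_fin sqn_ge0.
apply: nearW => M; apply: le_trans (zV M).
rewrite big_mkord exchange_big /= /psum -sumEFin; apply: lee_sum => j _.
by rewrite -sumEFin.
Qed.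

Lemma psum_series_fin (J : finType) (z : J -> nat -> C) (s : R) :
  (\sum_j \sum_(0 <= k <oo) sqmod (z j k))%E = s%:E ->
  (forall M, psum z M <= s) /\ (forall e : R, 0 < e -> exists M, s - e < psum z M).
Proof.
move=> sE; split=> [M|e e0]; first by have := psum_series_ge z M; rewrite sE lee_fin.
apply: contrapT => nM; have : ((s%:E <= (s - e)%:E))%E.
  rewrite -sE; apply: psum_series_le => M; rewrite lee_fin leNgt; apply/negP => lt.
  by apply: nM; exists M.
by rewrite lee_fin leNgt gtrBl e0.
Qed.

Section Limit.
Variables (J L : finType) (d : J -> nat -> C) (c : L -> nat -> C).
Variables (dec : nat -> J -> nat -> C) (Q : nat -> nat) (lam Lam s : R).
Hypotheses (lam0 : 0 <= lam) (Lam0 : 0 <= Lam).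
Hypothesis Q_ge : forall t, (t <= Q t)%N.
Hypothesis c_le : forall M, psum c M <= s.
Hypothesis c_lim : forall e : R, 0 < e -> exists M, s - e < psum c M.
Hypothesis dec_cvg : forall j k (e : R), 0 < e -> exists t0, forall t, (t0 <= t)%N ->
  sqn (d j k - dec (Q t) j k) < e.
Hypothesis dec_upper : forall n M, psum (dec n) M <= Lam * psum c n.
Hypothesis dec_lower : forall n (X : R), (forall M, psum (dec n) M <= X) ->
  lam * psum c n <= X.
Hypothesis dec_cauchy : forall n n' M, (n <= n')%N ->
  psum (fun j k => dec n j k - dec n' j k) M <= Lam * (psum c n' - psum c n).

(** Finitely many terms converge simultaneously. *)
Lemma dec_psum_cvg M e : 0 < e -> exists t0, forall t, (t0 <= t)%N ->
  psum (fun j k => d j k - dec (Q t) j k) M <= e.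
Proof.
move=> e0; pose B : R := (#|J| * M).+1%:R; have B0 : 0 < B by rewrite ltr0n.
have /choice [t0 t0P] : forall z : J * 'I_M, exists t0, forall t, (t0 <= t)%N ->
    sqn (d z.1 z.2 - dec (Q t) z.1 z.2) < e / B.
  by move=> [j k]; apply: dec_cvg; rewrite divr_gt0.
exists (\max_z t0 z) => t tt0; rewrite /psum pair_bigA /=.
apply: (@le_trans _ _ (\sum_(z : J * 'I_M) e / B)).
  apply: ler_sum => z _; apply/ltW/t0P; apply: leq_trans tt0.
  exact: (leq_bigmax z).
rewrite sumr_const card_prod card_ord -mulr_natl mulrA ler_pdivrMr //.
by rewrite mulrC ler_wpM2l ?(ltW e0) // ler_nat.
Qed.

(** The bound holds for the truncated outputs, and finite partial sums
    converge. *)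
Lemma limit_upper M : psum d M <= Lam * s.
Proof.
have s0 : 0 <= s by apply: le_trans (c_le 0); exact: psum_ge0.
apply: le_of_weighted; first exact: mulr_ge0.
move=> t e t0 e0; have [n nP] := dec_psum_cvg M e0.
apply: le_trans (psum_weighted d (dec (Q n)) M t0) _; apply: lerD.
  rewrite ler_wpM2l ?addr_ge0 ?(ltW t0) //.
  by apply: le_trans (dec_upper _ _) _; rewrite ler_wpM2l.
by rewrite ler_wpM2l ?addr_ge0 ?invr_ge0 ?(ltW t0) // nP.
Qed.

(** The lower bound for the output of a long truncation n controls s up to a
    small error. Replacing this output by d costs its distance to the output of
    a longer truncation, which is at most Lam times the mass of c beyond n, and
    the distance of the latter to d on finitely many terms. *)
Lemma limit_lower X : (forall M, psum d M <= X) -> lam * s <= X.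
Proof.
move=> dX; have X0 : 0 <= X by apply: le_trans (dX 0); exact: psum_ge0.
apply: le_of_weighted => // t e t0 e0.
have t1 : 0 < 1 + t^-1 by rewrite addr_gt0 // invr_gt0.
(* The mass of c beyond n is at most e2; this costs Lam e2 <= e / 8 in the
   distance of outputs and lam e2 <= e / 4 in the left-hand side. *)
pose e1 := e / 8 / (Lam + 1); have L1 : 0 < Lam + 1 by rewrite ltr_wpDl.
have e10 : 0 < e1 by rewrite !divr_gt0.
pose e2 := Num.min e1 (e / 4 / (lam + 1)).
have l1 : 0 < lam + 1 by rewrite ltr_wpDl.
have e20 : 0 < e2 by rewrite lt_min e10 !divr_gt0.
have [n0 n0P] := c_lim e20.
have sn : s - e2 < psum c (Q n0).
  by apply: lt_le_trans n0P _; apply: psum_le.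
set n := Q n0 in sn.
have low : lam * psum c n <= (1 + t) * X + (1 + t^-1) * (e / 2).
  apply: dec_lower => M; have e4 : 0 < e / 8 by rewrite divr_gt0.
  have [t1' tP] := dec_psum_cvg M e4.
  pose m := maxn t1' n; have nm : (n <= Q m)%N.
    exact: leq_trans (leq_maxr _ _) (Q_ge _).
  apply: le_trans (psum_weighted (dec n) d M t0) _; apply: lerD.
    by rewrite ler_wpM2l ?addr_ge0 ?(ltW t0) // dX.
  rewrite ler_wpM2l ?(ltW t1) //.
  have := psum_weighted (fun j k => dec n j k - d j k)
    (fun j k => dec n j k - dec (Q m) j k) M ltr01.
  rewrite invr1 => /le_trans; apply.
  have -> : psum (fun j k => dec n j k - d j k - (dec n j k - dec (Q m) j k)) M =
      psum (fun j k => d j k - dec (Q m) j k) M.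
    do 2 (apply: eq_bigr => ? _); rewrite -sqnN; congr sqn; ring.
  have := tP m (leq_maxl _ _); have := dec_cauchy M nm.
  have := c_le (Q m) => h1 h2 h3.
  have h4 : Lam * (psum c (Q m) - psum c n) <= e / 8.
    have : Lam * (psum c (Q m) - psum c n) <= (Lam + 1) * e1.
      apply: ler_pM => //; [by rewrite subr_ge0 psum_le|by rewrite lerDl|].
      have : e2 <= e1 by rewrite ge_min lexx.
      by move: sn h1; lra.
    by have -> : (Lam + 1) * e1 = e / 8 by rewrite /e1 mulrC divfK // gt_eqF.
  by move: h2 h3 h4; lra.
have : lam * s <= lam * psum c n + e / 4.
  have : lam * (s - psum c n) <= (lam + 1) * (e / 4 / (lam + 1)).
    apply: ler_pM => //; [by rewrite subr_ge0|by rewrite lerDl|].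
    have : e2 <= e / 4 / (lam + 1) by rewrite ge_min lexx orbT.
    by move: sn; lra.
  have -> : (lam + 1) * (e / 4 / (lam + 1)) = e / 4.
    by rewrite mulrC divfK // gt_eqF.
  by lra.
move=> /le_trans; apply.
have : e / 4 <= (1 + t^-1) * (e / 2).
  have : e / 4 <= e / 2 by lra.
  move=> /le_trans; apply; rewrite ler_peMl ?lerDl ?invr_ge0 ?(ltW t0) //.
  by rewrite ltW // divr_gt0.
have -> : (1 + t^-1) * e = (1 + t^-1) * (e / 2) + (1 + t^-1) * (e / 2) by field; exact: lt0r_neq0.
by move: low; lra.
Qed.

End Limit.
End TruncationLimit.

Section Decimation.
Context {R : realType} {K : topologicalFieldType}.
Local Notation C := R[i].
Variables (p c : nat) (eps : 'I_c -> K) (F : finFieldType) (f : {rmorphism F -> K}).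
Hypotheses (pK : p \in [pchar K]) (cardF : #|F| = (p ^ c)%N)
  (rangef : range f = prime_span eps).
Local Notation q := (p ^ c)%N.
Variables (N : nat) (a b : 'I_N -> nat -> C).

(** Substituting u(i) = u(qk) + u(m) permutes the indices below q^t. *)
Lemma decimated_correlation k t : (q * k < q ^ t)%N ->
  decimated pK rangef (q ^ t) a b k =
  \sum_(m < q ^ t) \sum_(j < N) (a j m)^* * b j (lat_shift pK rangef k m).
Proof.
move=> kt; have shlt (m : 'I_(q ^ t)) : (lat_shift pK rangef k m < q ^ t)%N.
  by rewrite (lat_shift_lt pK cardF rangef m kt).
have unlt (m : 'I_(q ^ t)) : (lat_unshift pK rangef k m < q ^ t)%N.
  by rewrite -(lat_shift_lt pK cardF rangef _ kt) (lat_unshiftK pK cardF).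
pose sh m := Ordinal (shlt m).
rewrite /decimated (reindex sh).
  by apply: eq_bigr => m _; apply: eq_bigr => j _; rewrite /= (lat_shiftK pK cardF).
exists (fun m => Ordinal (unlt m)) => m _; apply/val_inj => /=.
  exact: (lat_shiftK pK cardF).
exact: (lat_unshiftK pK cardF).
Qed.

(** The output is linear in the coefficients, and the difference of two
    truncations of b is b between n and n'. *)
Lemma decimated_tail n n' k : (n <= n')%N ->
  decimated pK rangef n' a b k - decimated pK rangef n a b k =
  decimated pK rangef n' a (fun j i => if (i < n)%N then 0 else b j i) k.
Proof.
move=> nn'; rewrite /decimated [X in _ - X](big_ord_widen n' (fun i =>
  \sum_(j < N) (a j (lat_unshift pK rangef k i))^* * b j i)) //.
rewrite [X in _ - X]big_mkcond -sumrB /=; apply: eq_bigr => i _.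
case: ifP => _; last by rewrite subr0.
by rewrite subrr big1 // => j _; rewrite mulr0.
Qed.

End Decimation.

Lemma psum_tail {R : realType} (L : finType) (b : L -> nat -> R[i]) n n' :
  (n <= n')%N ->
  psum (fun j i => if (i < n)%N then 0 else b j i) n' = psum b n' - psum b n.
Proof.
move=> nn'; rewrite /psum -sumrB; apply: eq_bigr => j _.
rewrite [X in _ - X](big_ord_widen n' (fun i => sqn (b j i))) // [X in _ - X]big_mkcond -sumrB.
by apply: eq_bigr => i _; case: ifP => _; rewrite ?subrr ?subr0 ?sqn0.
Qed.

Lemma psum_allpairs {R : realType} (L : finType) (G : L * nat -> R[i]) M :
  psum (fun j k => G (j, k)) M =
  \sum_(z <- [seq (j, k) | j <- enum L, k <- iota 0 M]) sqn (G z).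
Proof.
rewrite big_allpairs_dep /= big_enum /=; apply: eq_bigr => j _.
by rewrite -(big_mkord xpredT (fun k => sqn (G (j, k)))) /index_iota subn0.
Qed.

(** * The theorem *)

Theorem mainTheorem4
    (R : realType) (K : topologicalFieldType) (K_local : local_field K)
    (p : nat) (K_char : p \in [pchar K])
    (mu : {measure set (borel K) -> \bar R}) (mu_haar : haar_measure mu)
    (abs : K -> R) (abs_mu : haar_modulus mu abs)
    (mu_int : mu (int_ring abs) = 1%E)
    (varpi : K) (varpi_prime : prime_element abs varpi)
    (c q : nat) (q_def : q = (p ^ c)%N) (q_card : residue_field_card abs q)
    (eps : 'I_c -> K) (eps_basis : residue_basis abs p eps)
    (chi : K -> R[i]) (chi_basic : basic_character p eps varpi chi)
    (N : nat) (phi : 'I_N -> K -> R[i])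
    (phi_L2 : forall j, L2 mu (phi j))
    (phi_frame :
       let shifts (i : 'I_N * nat) (x : K) :=
         phi i.1 (x - u p eps varpi i.2) in
       frame_for mu (closed_lin_span mu shifts) shifts)
    (hc : 'I_q -> 'I_N -> 'I_N -> nat -> R[i])
    (hc_l2 : forall r l j, l2_seq (hc r l j))
    (psi : 'I_q -> 'I_N -> K -> R[i])
    (psi_def : forall r l,
       L2_series_on mu [set: K]
         (fun k x => sqrtC q%:R * \sum_(j < N)
            hc r l j k * phi j (varpi^-1 * x - u p eps varpi k))
         (psi r l))
    (h : 'I_q -> 'I_N -> 'I_N -> K -> R[i])
    (h_series : forall r l j,
       L2_series_on mu (int_ring abs)
         (fun k xi => (sqrtC q%:R)^-1 *
            (hc r l j k * (chi (u p eps varpi k * xi))^*))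
         (h r l j))
    (h_periodic : forall r l j n,
       {ae mu, forall xi, h r l j (xi + u p eps varpi n) = h r l j xi})
    (lam Lam : \bar R)
    (lam_def : lam = ess_inf mu (fun xi : borel K =>
       (min_eigenvalue (gram (H_matrix varpi (u p eps varpi) h xi)))%:E))
    (Lam_def : Lam = ess_sup mu (fun xi : borel K =>
       (max_eigenvalue (gram (H_matrix varpi (u p eps varpi) h xi)))%:E))
    (lam_gt0 : (0 < lam)%E) (lam_le : (lam <= Lam)%E)
    (Lam_fin : (Lam < +oo)%E)
    (g : K -> R[i]) (g_L2 : L2 mu g) :
  let S_phi : \bar R :=
    (\sum_(l < N) \sum_(0 <= k <oo)
       sqmod (inner mu g (fun x =>
         (sqrtC q%:R * phi l (varpi^-1 * x - u p eps varpi k))%R)))%E in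
  let S_psi : \bar R :=
    (\sum_(s < q) \sum_(l < N) \sum_(0 <= k <oo)
       sqmod (inner mu g (fun x => psi s l (x - u p eps varpi k)%R)))%E in
  (lam * S_phi <= S_psi)%E /\ (S_psi <= Lam * S_phi)%E.
Proof.
move=> S_phi S_psi.
case: eps_basis => eps0 eps_int [F [f [cardF rangef]]].
have {}eps_int i : int_ring abs (eps i) by case: (eps_int i).
subst q.
pose q := (p ^ c)%N; pose sq := sqrtC (q%:R : R[i]).
pose un := u p eps varpi.
have varpi0 := prime_element_neq0 K_local mu_haar abs_mu varpi_prime.
have q_gt1 : (1 < q)%N by rewrite /q -cardF card_finNzRing_gt1.
have mT : measurable ([set: K] : set (borel K)) by exact: measurableT.
have [l lE] : exists l : R, lam = l%:E.
  move: lam_gt0 (le_lt_trans lam_le Lam_fin); case: (lam) => [l| |] // _ _.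
  by exists l.
have [L LE] : exists L : R, Lam = L%:E.
  move: (lt_le_trans lam_gt0 lam_le) Lam_fin; case: (Lam) => [L| |] // _ _.
  by exists L.
have l0 : 0 <= l by rewrite -lee_fin -lE ltW.
have L0 : 0 <= L by rewrite -lee_fin -LE (le_trans (ltW lam_gt0)).
have l_ae : {ae mu, forall xi : borel K,
    l <= min_eigenvalue (gram (H_matrix varpi un h xi))}.
  have := ess_inf_le mu (fun xi : borel K =>
    (min_eigenvalue (gram (H_matrix varpi un h xi)))%:E).
  by rewrite -lam_def lE; apply: filterS => xi; rewrite lee_fin.
have L_ae : {ae mu, forall xi : borel K,
    max_eigenvalue (gram (H_matrix varpi un h xi)) <= L}.
  have := ess_sup_ge mu (fun xi : borel K =>
    (max_eigenvalue (gram (H_matrix varpi un h xi)))%:E).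
  by rewrite -Lam_def LE; apply: filterS => xi; rewrite lee_fin.
(* cf is the family c_j(k), d the family d^r_l(k), and dec n the output of cf
   truncated to indices below n. *)
pose x (i : 'I_N * nat) t := phi i.1 (t - un i.2).
have Lx i : L2_on mu [set: K] (x i).
  by apply: (L2_shift mu_haar mT) => //; exact: phi_L2.
pose y (i : 'I_N * nat) t := sq * x i (varpi^-1 * t).
have vV0 : varpi^-1 != 0 by rewrite invr_eq0.
have abs0' := abs_ge0 K_local mu_haar abs_mu.
have Ly i : L2_on mu [set: K] (y i).
  by apply: L2Z => //; exact: (L2_dilate abs_mu abs0' vV0 (Lx i)).
have [B B0 syn] := synthesis_bound_dilate abs_mu abs0' sq vV0 Lx phi_frame.
pose cf j k := inner_on mu [set: K] g (y (j, k)).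
have cf_le M : psum cf M <= B * nsq mu [set: K] g.
  rewrite (psum_allpairs (fun z => inner_on mu [set: K] g (y z))).
  apply: (bessel_of_synthesis B0 Ly syn g_L2).
  apply: allpairs_uniq; [exact: enum_uniq|exact: iota_uniq|].
  by move=> [? ?] [? ?].
have S_phiE : S_phi = (\sum_j \sum_(0 <= k <oo) sqmod (cf j k))%E by [].
have [s sE] : exists s : R, S_phi = s%:E.
  have := psum_series_le (z := cf) (V := (B * nsq mu [set: K] g)%:E) _.
  rewrite -S_phiE => /(_ _)/le_lt_trans fin.
  exists (fine S_phi); rewrite fineK // ge0_fin_numE.
    by apply: fin; [move=> M; rewrite lee_fin|exact: ltry].
  by rewrite S_phiE; apply: sume_ge0 => j _; apply: nneseries_ge0 => *; exact: sqmod_ge0.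
have [c_le c_lim] := psum_series_fin (etrans (esym S_phiE) sE).
pose d (z : 'I_q * 'I_N) k :=
  inner_on mu [set: K] g (fun t => psi z.1 z.2 (t - un k)).
have S_psiE : S_psi = (\sum_z \sum_(0 <= k <oo) sqmod (d z k))%E.
  by rewrite /S_psi pair_bigA.
pose dec n (z : 'I_q * 'I_N) := decimated K_char rangef n (hc z.1 z.2) cf.
(* Convergence along n = q^t only: there the truncated output is a partial sum
   of the series obtained by expanding psi. *)
have dec_cvg z k (e : R) : 0 < e -> exists t0, forall t, (t0 <= t)%N ->
    sqn (d z k - dec (q ^ t)%N z k) < e.
  move=> e0; pose tm m t := sq * \sum_(j < N) hc z.1 z.2 j m * phi j (varpi^-1 * t - un m).
  have tmE m : tm m = (fun t => \sum_(j < N) hc z.1 z.2 j m * y (j, m) t).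
    apply/funext => t; rewrite /tm mulr_sumr; apply: eq_bigr => j _.
    by rewrite mulrCA.
  have Ltm m : L2_on mu [set: K] (tm m).
    by rewrite tmE; apply: L2_sum => // j; exact: L2Z.
  have [n0 n0P] := inner_shift_series mu_haar (un k) (psi_def z.1 z.2) Ltm g_L2 e0.
  exists (maxn n0 k.+1) => t; rewrite geq_max => /andP[tn tk].
  have nt : (n0 <= q ^ t)%N by apply: leq_trans tn _; exact/ltnW/ltn_expl.
  have kt : (q * k < q ^ t)%N.
    apply: leq_trans (leq_pexp2l (ltnW q_gt1) tk).
    by rewrite expnS ltn_pmul2l ?(ltnW q_gt1) // ltn_expl.
  have := n0P _ nt; congr (sqn (_ - _) < _).
  rewrite /dec decimated_correlation //; apply: eq_bigr => m _.
  have -> : (fun t => tm m (t - un k)) =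
      (fun t => \sum_(j < N) hc z.1 z.2 j m * y (j, lat_shift K_char rangef k m) t).
    apply/funext => t'; rewrite tmE; apply: eq_bigr => j _.
    rewrite /y /x /= /un (u_shift varpi K_char cardF rangef).
    by congr (_ * (_ * phi _ _)); rewrite mulrBr opprD addrA.
  rewrite (@inner_sumr _ _ mu _ mT _ _ (fun j : 'I_N => fun t =>
    hc z.1 z.2 j m * y (j, lat_shift K_char rangef k m) t) g) //.
    by apply: eq_bigr => j _; rewrite innerZr.
  by move=> j; exact: L2Z.
have upper n b : (\sum_z \sum_(0 <= k <oo)
    sqmod (decimated K_char rangef n (hc z.1 z.2) b k) <= (L * psum b n)%:E)%E.
  have := decimated_upper K_local mu_haar abs_mu mu_int K_char cardF rangef
    varpi_prime eps0 eps_int chi_basic n b h_series L0 L_ae.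
  by rewrite pair_bigA.
have lower n : ((l * psum cf n)%:E <=
    \sum_z \sum_(0 <= k <oo) sqmod (dec n z k))%E.
  have := decimated_lower K_local mu_haar abs_mu mu_int K_char cardF rangef
    varpi_prime eps0 eps_int chi_basic n cf h_series l0 l_ae.
  by rewrite [X in (_ <= X)%E]pair_bigA.
have psum_upper n b M :
    psum (fun z k => decimated K_char rangef n (hc z.1 z.2) b k) M <= L * psum b n.
  by rewrite -lee_fin; apply: le_trans (psum_series_ge _ _) (upper n b).
have d_upper M : psum d M <= L * s.
  have limU := @limit_upper R _ _ d cf dec (fun t => q ^ t)%N L s L0 c_le dec_cvg.
  apply: limU => n M'.
  exact: (psum_upper n cf M').
split.
  rewrite lE sE S_psiE -EFinM.
  have := psum_series_le (z := d) (V := (L * s)%:E) _.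
  move=> /(_ _)/le_lt_trans fin.
  have dfin : (\sum_z \sum_(0 <= k <oo) sqmod (d z k))%E \is a fin_num.
    rewrite ge0_fin_numE.
      by apply: fin; [move=> M; rewrite lee_fin|exact: ltry].
    by apply: sume_ge0 => j _; apply: nneseries_ge0 => *; exact: sqmod_ge0.
  rewrite -(fineK dfin) lee_fin.
  have q_ge t : (t <= q ^ t)%N by exact/ltnW/ltn_expl.
  have limL := @limit_lower R _ _ d cf dec (fun t => q ^ t)%N l L s l0 L0 q_ge
    c_le c_lim dec_cvg.
  apply: limL.
  - move=> n X decX; rewrite -lee_fin; apply: le_trans (lower n) _.
    by apply: psum_series_le => M; rewrite lee_fin.
  - move=> n n' M nn'; rewrite -psum_tail //.
    apply: le_trans (psum_upper n' _ M); rewrite le_eqVlt; apply/orP; left; apply/eqP.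
    do 2 (apply: eq_bigr => ? _); rewrite -sqnN opprB; congr sqn.
    exact: decimated_tail.
  - by move=> M; rewrite -lee_fin (fineK dfin); exact: psum_series_ge.
rewrite LE sE S_psiE -EFinM; apply: psum_series_le => M.
by rewrite lee_fin.
Qed.
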